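(* Let $G$ be a connected graph of order $n$. Then $\lambda_2(G)<1/2$ if and only if $G$ is (isomorphic to) one of the following graphs: (1) $(\overline{K_2}\cup K_2)\vee\overline{K_s}$, $s\ge 1$; (2) $(K_1\cup(\overline{K_s}\vee\overline{P_3}))\vee K_1$, $s\ge 1$; (3) $(K_1\cup(\overline{K_s}\vee K_3))\vee K_1$, $s\ge 1$; (4) $(K_1\cup(\overline{K_s}\vee\overline{K_2}\vee K_2))\vee K_1$, $2\le s\le 3$; (5) $(K_1\cup(\overline{K_{s_1}}\vee\overline{K_{s_2}}\vee\overline{K_{s_3}}))\vee\overline{K_t}$, $s_1\ge s_2\ge s_3\ge 1$, $s_1>1$, $t\geq 1$, $t<\frac{\alpha(s_1,s_2,s_3)}{\beta(s_1,s_2,s_3)}$; (6) $(K_1\cup K_3)\vee\overline{K_t}$, $t\ge 1$; (7) $(p\circ(K_1\cup K_{1,2}))\vee(q\circ(K_1\cup K_{1,1}))\vee\overline{K_{s_{p+q+1}}}\vee\cdots\vee\overline{K_{s_k}}$, $p,q\ge 0$; (8) $(K_1\cup K_{1,t})\vee(p\circ(K_1\cup K_{1,1}))\vee\overline{K_{s_{p+2}}}\vee\cdots\vee\overline{K_{s_k}}$, $t\ge 3$, $p\ge 0$, $\gamma(p,t)<0$; (9) $(K_1\cup K_{1,3})\vee(K_1\cup K_{1,2})\vee\overline{K_{s_3}}\vee\cdots\vee\overline{K_{s_k}}$, $\sum_{i=3}^k\frac{2s_i}{2s_i+1}<3$; (10) $(K_1\cup K_{1,3})\vee(K_1\cup K_{1,2})\vee(K_1\cup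 K_{1,1})\vee\overline{K_s}$, $s\ge 0$; (11) $(K_1\cup K_{2,2})\vee(K_1\cup K_{1,1})\vee\overline{K_s}$, $s\ge 0$; (12) $(K_1\cup K_{2,3})\vee(K_1\cup K_{1,1})$; (13) $(K_1\cup K_{s,t})\vee\overline{K_{s_2}}\vee\cdots\vee\overline{K_{s_k}}$, $s,t\ge 2$, $\delta(1/2,s,t,s_2,\ldots,s_k)<0$.
   Context: All graphs are finite and simple. $\lambda_i(G)$ is the $i$-th largest eigenvalue (with multiplicity) of the adjacency matrix of $G$; speaking of $\lambda_2(G)$ presupposes $G$ has at least two vertices. $G\cup H$ is the disjoint union; $G\vee H$ is the join (obtained from $G\cup H$ by joining every vertex of $G$ to every vertex of $H$); $p\circ G$ is the join of $p$ copies of $G$; $\overline{G}$ is the complement. $K_m$, $K_{s,t}$, $P_m$ are the complete graph on $m$ vertices, the complete bipartite graph and the path on $m$ vertices, so $\overline{K_m}$ is the edgeless graph on $m$ vertices. In (7), (8), (9), (13), $k\ge 2$ is an integer counting the join factors of the whole graph (each copy in $p\circ(\cdot)$ or $q\circ(\cdot)$ counts as one factor), with $k\ge p+q$ in (7) and $k\ge p+1$ in (8); all $s_i$ are integers $\ge 1$; the list of factors $\overline{K_{s_i}}$ may be empty when the index range is empty (empty sums are $0$). A join factor $0\circ(\cdot)$ or $\overline{K_0}$ is simply absent. Definitions: $\alpha(s_1,s_2,s_3)=16s_1s_2s_3+4(s_1s_2+s_2s_3+s_1s_3)-1$; $\beta(s_1,s_2,s_3)=16s_1s_2s_3-4(s_1+s_2+s_3+1)$;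 $\gamma(p,t)=4tp-10p-4t+1+(2t-5)\sum_{i=p+2}^k\frac{2s_i}{2s_i+1}$ (it depends also on $s_{p+2},\ldots,s_k$); $\delta(\lambda,s,t,s_2,\ldots,s_k)=\left(1-\sum_{i=2}^k\frac{s_i}{\lambda+s_i}\right)\left(\lambda^3+(s+t+1)\lambda^2+st\lambda-st\right)-(s+t+1)\lambda^2-2st\lambda+st$. *)

(* Defs.v *)
From HB Require Import structures.
From mathcomp Require Import all_boot all_order all_algebra.
From mathcomp Require Import polyrcf.

Set Implicit Arguments.
Unset Strict Implicit.
Unset Printing Implicit Defensive.

Import Order.TTheory GRing.Theory Num.Theory.

Record sgraph := SGraph {
  vertex :> finType;
  adj : rel vertex;
  adj_sym : symmetric adj;
  adj_irr : irreflexive adj }.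

Arguments adj {s} x y.

Declare Scope graph_scope.
Delimit Scope graph_scope with G.
Bind Scope graph_scope with sgraph.

Definition giso (G H : sgraph) : Prop :=
  exists2 f : G -> H, bijective f & {mono f : x y / adj x y}.

(* For a graph with at least one vertex, this is connectedness. *)
Definition connectedg (G : sgraph) : Prop := forall x y : G, connect adj x y.

Section Constructions.

Definition complete_rel m : rel 'I_m := fun i j => i != j.

Fact complete_sym m : symmetric (@complete_rel m).
Proof. by move=> i j; rewrite /complete_rel eq_sym. Qed.

Fact complete_irr m : irreflexive (@complete_rel m).
Proof. by move=> i; rewrite /complete_rel eqxx. Qed.

Definition complete m := SGraph (@complete_sym m) (@complete_irr m).

Definition path_rel m : rel 'I_m := fun i j => (i.+1 == j) || (j.+1 == i).

Fact path_sym m : symmetric (@path_rel m).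
Proof. by move=> i j; rewrite /path_rel orbC. Qed.

Fact path_irr m : irreflexive (@path_rel m).
Proof. by move=> i; rewrite /path_rel orbb eqn_leq ltnn. Qed.

Definition pathg m := SGraph (@path_sym m) (@path_irr m).

Definition compl_rel (G : sgraph) : rel G := fun x y => (x != y) && ~~ adj x y.

Fact compl_sym G : symmetric (@compl_rel G).
Proof. by move=> x y; rewrite /compl_rel eq_sym adj_sym. Qed.

Fact compl_irr G : irreflexive (@compl_rel G).
Proof. by move=> x; rewrite /compl_rel eqxx. Qed.

Definition gcompl G := SGraph (@compl_sym G) (@compl_irr G).

(* The boolean [b] tells whether vertices of different summands are adjacent. *)
Definition sum_rel (b : bool) (G H : sgraph) : rel (G + H)%type :=
  fun u v => match u, v with
             | inl x, inl y => adj x y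
             | inr x, inr y => adj x y
             | _, _ => b
             end.

Fact sum_sym b G H : symmetric (@sum_rel b G H).
Proof. by case=> x [] y //=; rewrite adj_sym. Qed.

Fact sum_irr b G H : irreflexive (@sum_rel b G H).
Proof. by case=> x /=; rewrite adj_irr. Qed.

Definition gunion G H := SGraph (@sum_sym false G H) (@sum_irr false G H).
Definition gjoin G H := SGraph (@sum_sym true G H) (@sum_irr true G H).

End Constructions.

Notation "''K_' m" := (complete m)
  (at level 8, m at level 2, format "''K_' m") : graph_scope.
Notation "''P_' m" := (pathg m)
  (at level 8, m at level 2, format "''P_' m") : graph_scope.
Notation "G :+: H" := (gunion G H)
  (at level 50, left associativity) : graph_scope.
Notation "G :\/: H" := (gjoin G H)
  (at level 52, left associativity) : graph_scope.
Notation "''K_' ( s , t )" := (gjoin (gcompl (complete s)) (gcompl (complete t)))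
  (at level 8, format "''K_' ( s ,  t )") : graph_scope.

(* The join of an empty family is the graph without vertices, which is neutral
   for the join up to isomorphism: absent join factors need no special case. *)
Definition gjoins (Gs : seq sgraph) : sgraph := foldr gjoin (complete 0) Gs.

Definition join_copies (p : nat) (G : sgraph) : sgraph := gjoins (nseq p G).

(* The factors are indexed by i = a, ..., k, both ends included. *)
Definition multipartite (s : nat -> nat) (a k : nat) : sgraph :=
  gjoins [seq gcompl (complete (s i)) | i <- index_iota a k.+1].

Section Spectrum.

Variable R : rcfType.

Local Open Scope ring_scope.

Definition adjmx (G : sgraph) : 'M[R]_#|G| :=
  \matrix_(i, j) (adj (enum_val i) (enum_val j))%:R.

(* All roots in R of the characteristic polynomial, each repeated according to
   its multiplicity, in nonincreasing order. *)
Definition spectrum (G : sgraph) : seq R :=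
  let chi := char_poly (adjmx G) in
  sort >=%R (flatten [seq nseq (mup x chi) x | x <- rootsR chi]).

(* Numbered from 1; meaningful for 1 <= i <= #|G|. *)
Definition eigval (i : nat) (G : sgraph) : R := nth 0 (spectrum G) i.-1.

End Spectrum.

Section Thresholds.

Variable R : fieldType.

Local Open Scope ring_scope.

Definition alpha (s1 s2 s3 : nat) : R :=
  16 * s1%:R * s2%:R * s3%:R
  + 4 * (s1%:R * s2%:R + s2%:R * s3%:R + s1%:R * s3%:R) - 1.

Definition beta (s1 s2 s3 : nat) : R :=
  16 * s1%:R * s2%:R * s3%:R - 4 * (s1%:R + s2%:R + s3%:R + 1).

Definition gamma (p t k : nat) (s : nat -> nat) : R :=
  4 * t%:R * p%:R - 10 * p%:R - 4 * t%:R + 1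
  + (2 * t%:R - 5)
    * \sum_(p.+2 <= i < k.+1) (2 * (s i)%:R) / (2 * (s i)%:R + 1).

(* Only the values s 2, ..., s k are used. *)
Definition delta (x : R) (a t k : nat) (s : nat -> nat) : R :=
  (1 - \sum_(2 <= i < k.+1) (s i)%:R / (x + (s i)%:R))
  * (x ^+ 3 + (a%:R + t%:R + 1) * x ^+ 2 + a%:R * t%:R * x - a%:R * t%:R)
  - (a%:R + t%:R + 1) * x ^+ 2 - 2 * a%:R * t%:R * x + a%:R * t%:R.

End Thresholds.

(* Main.v *)
From Corelib Require Import Setoid Morphisms.
Require Import Defs.
From mathcomp Require Import all_boot all_order all_algebra.
From mathcomp Require Import polyrcf complex spectral sesquilinear.
From mathcomp Require Import ring lra zify.

(* Let q(x) = x^T (1/2 - A) x. By the spectral theorem, lambda_2 < 1/2 when q is positive on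
   a hyperplane, and then every plane contains a vector where q is positive. Planes supported
   on four vertices exclude P_4 and 2 K_2 as induced subgraphs, so the complement of G is
   trivially perfect: each of its components is a vertex joined to a smaller such graph.
   In terms of the complement, q(x) + (1^T x)^2 = x^T B x with B = 3/2 + A(complement), and B
   is the direct sum of its restrictions to the components. When B > 0 on a graph, everything
   depends on F = 1^T B^-1 1, which is additive over components and becomes
   (2 - F) / (3 - 2 F) when a dominating vertex is added to the complement; positivity
   persists exactly when F < 3/2. Hence the components with B > 0 are the cliques K_m, with
   F = 2m / (2m + 1), the path P_3, with F = 2, and the paw, with F = 8. At most one component
   of the complement can fail B > 0; it is a dominating vertex over components with B > 0 of
   total value F >= 3/2, and if the other components have total value K, then lambda_2 < 1/2
   if and only if K (2 F - 3) < F - 1. The list enumerates the solutions. *)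

Set Implicit Arguments.
Unset Strict Implicit.
Unset Printing Implicit Defensive.

Import Order.TTheory GRing.Theory Num.Theory.

(** * Real symmetric matrices and the second eigenvalue *)

Section Spectral.
Variable R : rcfType.
Local Open Scope ring_scope.
Local Open Scope sesquilinear_scope.
Local Notation C := R[i].
Local Notation rc := (real_complex R).

Lemma conj_rc (x : R) : (rc x)^* = rc x.
Proof. by rewrite conj_Creal // complex_real. Qed.

(** Over [R[i]] the matrix is hermitian, so the spectral theorem applies and its diagonal is real.
    The factorization of the characteristic polynomial descends to [R] because [rc] is injective on
    polynomials. *)
Lemma symmetric_diagonalization n (A : 'M[R]_n) : A^T = A ->
  exists (P : 'M[C]_n) (r : 'I_n -> R),
  [/\ P \is unitarymx,
      map_mx rc A = P ^t* *m diag_mx (\row_i rc (r i)) *m P &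
      char_poly A = \prod_i ('X - (r i)%:P)].
Proof.
move=> symA; have hA : map_mx rc A \is hermsymmx.
  apply: realsym_hermsym; last first.
    by apply/mxOverP => i j; rewrite !mxE complex_real.
  apply/is_hermitianmxP; rewrite expr0 scale1r map_mx_id //.
  by rewrite map_trmx symA.
have hP := spectral_unitarymx (map_mx rc A).
have /hermitian_normalmx/orthomx_spectralP := hA.
have /mxOverP := hermitian_spectral_diag_real hA.
set P := spectralmx _ in hP *; set sp := spectral_diag _ => hsp dA.
pose r i := complex.Re (sp 0 i).
have spE : sp = \row_i rc (r i).
  by apply/rowP => i; rewrite mxE RRe_real.
exists P, r; split => //; first by rewrite -invmx_unitary // -spE.
apply: (map_poly_inj rc); rewrite map_char_poly /char_poly.
rewrite rmorph_prod /=.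
have -> : char_poly_mx (map_mx rc A) =
    map_mx polyC (invmx P) *m char_poly_mx (diag_mx sp) *m map_mx polyC P.
  rewrite /char_poly_mx mulmxBr mulmxBl -!map_mxM -dA; congr (_ - _).
  rewrite scalar_mxC -mulmxA -map_mxM mulVmx ?spectral_unit //.
  by rewrite map_mx1 mulmx1.
rewrite !det_mulmx mulrAC -det_mulmx -map_mxM mulVmx ?spectral_unit //.
rewrite map_mx1 det1 mul1r -/(char_poly _) char_poly_trig ?diag_mx_is_trig //.
apply: eq_bigr => i _; rewrite spE !mxE eqxx mulr1n.
by rewrite rmorphB /= map_polyX map_polyC.
Qed.

Lemma nth1_sort_lt (c : R) (s : seq R) : (2 <= size s)%N ->
  (nth 0 (sort >=%R s) 1 < c) = (count (>= c) s <= 1)%N.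
Proof.
move=> s2; have /permP/(_ (>= c)) <- : perm_eq (sort >=%R s) s.
  by rewrite perm_sort.
have: (2 <= size (sort >=%R s))%N by rewrite size_sort.
have: sorted >=%R (sort >=%R s).
  by apply: sort_sorted => x y; apply: le_total.
case: (sort _ _) => [|x [|y t]] //= /andP[xy]; rewrite path_sortedE; last first.
  by move=> u v w; rewrite /= => /[swap]; apply: le_trans.
case/andP=> /allP yt _ _; case: leP => cy.
  by rewrite (le_trans cy xy).
suff -> : count (>= c) t = 0%N by case: (c <= x).
apply/eqP; rewrite -leqn0 leqNgt -has_count; apply/negP => /hasP[z zt /=].
by apply/negP; rewrite -ltNge (le_lt_trans (yt _ zt)).
Qed.

(** For a split characteristic polynomial, this identifies the list sorted in [spectrum] with the
    list of diagonal entries. *)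
Lemma count_roots (s : seq R) (chi := \prod_(x <- s) ('X - x%:P)) :
  perm_eq (flatten [seq nseq (mup x chi) x | x <- rootsR chi]) s.
Proof.
have chi0 : chi != 0 by rewrite monic_neq0 ?monic_prod_XsubC.
apply/allP => x _; rewrite /= count_flatten -map_comp.
have mE y : mup y chi = count_mem y s by rewrite mu_prod_XsubC.
rewrite sumnE big_map; under eq_bigr => y _ do
  rewrite /= count_nseq mE /=.
have [xs|xs] := boolP (x \in s); last first.
  rewrite (count_memPn xs) big1_seq // => y _; case: eqP => // ->.
  by rewrite (count_memPn xs) muln0.
have xr : x \in rootsR chi.
  by rewrite -(roots_on_rootsR chi0) root_prod_XsubC xs.
rewrite (bigD1_seq x) ?uniq_roots //= eqxx mul1n big1 ?addn0 // => y.
by move/negPf->; rewrite mul0n.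
Qed.

Lemma eigval2_lt (G : sgraph) (r : 'I_#|G| -> R) (c : R) : (2 <= #|G|)%N ->
  char_poly (adjmx R G) = \prod_i ('X - (r i)%:P) ->
  (eigval R 2 G < c) = (#|[pred i | (c <= r i)%R]| <= 1)%N.
Proof.
move=> G2 chiE; rewrite /eigval /spectrum chiE.
have -> : \prod_i ('X - (r i)%:P) = \prod_(x <- [seq r i | i <- enum 'I_#|G|]) ('X - x%:P).
  by rewrite big_map big_enum.
have pe := count_roots [seq r i | i <- enum 'I_#|G|].
rewrite nth1_sort_lt; last first.
  by rewrite (perm_size pe) size_map size_enum_ord.
have -> : #|[pred i | (c <= r i)%R]| =
    count [pred i | c <= r i] (enum (pred_of_simpl (@predT (ordinal #|G|)))).
  by rewrite cardE enumT -size_filter.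
by rewrite (permP pe) count_map.
Qed.

Definition mxform n (A : 'M[R]_n) (x : 'cV[R]_n) : R := (x^T *m A *m x) 0 0.

Definition hermform n (A : 'M[R]_n) (z : 'cV[C]_n) : C :=
  (z ^t* *m map_mx rc A *m z) 0 0.

(** The mixed terms cancel by symmetry of [A]. This is how signs over [R[i]] are brought back to
    real vectors. *)
Lemma hermformE n (A : 'M[R]_n) (x y : 'cV[R]_n) : A^T = A ->
  hermform A (map_mx rc x + 'i *: map_mx rc y) = rc (mxform A x + mxform A y).
Proof.
move=> symA; rewrite /hermform /mxform.
have -> : (map_mx rc x + 'i *: map_mx rc y) ^t* =
   map_mx rc x^T - 'i *: map_mx rc y^T.
  apply/matrixP => i j; rewrite !mxE rmorphD rmorphM /= !conj_rc conjCi.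
  by rewrite mulNr.
rewrite !(mulmxDl, mulmxDr, mulNmx, mulmxN) -!(scalemxAl, scalemxAr) -!map_mxM.
have -> : y^T *m A *m x = x^T *m A *m y.
  have t1 (M : 'M[R]_1) : M^T = M by apply/matrixP => i j; rewrite mxE !ord1.
  by rewrite -[LHS]t1 !trmx_mul trmxK symA mulmxA.
by rewrite scalerA -expr2 sqrCi scaleN1r opprK addrA subrK -map_mxD !{1}mxE.
Qed.


Lemma hermform_diag n (A : 'M[R]_n) (P : 'M[C]_n) (r : 'I_n -> R) z :
  map_mx rc A = P ^t* *m diag_mx (\row_i rc (r i)) *m P ->
  hermform A z = \sum_i rc (r i) * `|(P *m z) i 0| ^+ 2.
Proof.
rewrite /hermform => ->; rewrite !mulmxA -!map_mxM -trmx_mul -mulmxA mxE.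
apply: eq_bigr => i _; rewrite mul_mx_diag !{1}mxE normCK.
by rewrite mulrAC mulrC [_^* * _]mulrC.
Qed.

Lemma unitary_shift n (A : 'M[R]_n) (P : 'M[C]_n) (r : 'I_n -> R) (c : R) :
  P \is unitarymx ->
  map_mx rc A = P ^t* *m diag_mx (\row_i rc (r i)) *m P ->
  map_mx rc (c%:M - A) = P ^t* *m diag_mx (\row_i rc (c - r i)) *m P.
Proof.
move=> uP dA; rewrite map_mxB dA map_scalar_mx /=.
have -> : \row_i rc (c - r i) = const_mx (rc c) - \row_i rc (r i).
  by apply/rowP => i; rewrite !mxE rmorphB.
rewrite raddfB /= diag_const_mx mulmxBr mulmxBl; congr (_ - _).
by rewrite scalar_mxC -mulmxA -invmx_unitary // mulVmx ?unitarymx_unit // mulmx1.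
Qed.

(** Some nonzero complex combination of [x] and [y] has no component along the eigenvector [i0], so
    the hermitian form is positive there. Its real and imaginary parts lie in the real plane, and
    the form is positive at one of them. *)
Lemma plane_pos_of_count n (A : 'M[R]_n) (P : 'M[C]_n) (r : 'I_n -> R) i0 :
  A^T = A -> P \is unitarymx ->
  map_mx rc A = P ^t* *m diag_mx (\row_i rc (r i)) *m P ->
  (forall i, i != i0 -> 0 < r i) ->
  forall x y : 'cV[R]_n,
  (forall a b : R, a *: x + b *: y = 0 -> a = 0 /\ b = 0) ->
  exists a b, 0 < mxform A (a *: x + b *: y).
Proof.
move=> symA uP dA rpos x y indep.
pose X := map_mx rc x; pose Y := map_mx rc y.
have [al [be [nz z0]]] : exists al be : C, (al != 0) || (be != 0) /\
    (P *m (al *: X + be *: Y)) i0 0 = 0.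
  have E (al be : C) : (P *m (al *: X + be *: Y)) i0 0 =
      al * (P *m X) i0 0 + be * (P *m Y) i0 0.
    by rewrite mulmxDr -!scalemxAr !{1}mxE.
  have [x0|x0] := eqVneq ((P *m X) i0 0) 0.
    by exists 1, 0; rewrite oner_eq0 E x0 mulr0 mul0r addr0.
  exists ((P *m Y) i0 0), (- (P *m X) i0 0).
  by rewrite oppr_eq0 x0 orbT E; split=> //; ring.
pose a := complex.Re al; pose a' := complex.Im al.
pose b := complex.Re be; pose b' := complex.Im be.
have zE : al *: X + be *: Y =
    map_mx rc (a *: x + b *: y) + 'i *: map_mx rc (a' *: x + b' *: y).
  rewrite (complexE al) (complexE be) -/a -/a' -/b -/b'.
  rewrite !map_mxD !map_mxZ /= -/X -/Y; apply/matrixP => i j; rewrite !mxE -complexiE.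
  ring.
set z := _ + _ in z0 zE.
have zN0 : z != 0.
  apply/eqP => z0'; move: zE; rewrite z0' => zE.
  have [h1 h2] : a *: x + b *: y = 0 /\ a' *: x + b' *: y = 0.
    split; apply/matrixP => i j; move/matrixP/(_ i j)/esym/eqP: zE;
    rewrite !mxE -complexiE; simpc; rewrite eq_complex /=; by case/andP=> /eqP h /eqP h'.
  have [a0 b0] := indep _ _ h1; have [a'0 b'0] := indep _ _ h2.
  move: nz; rewrite (complexE al) (complexE be) -/a -/a' -/b -/b'.
  by rewrite a0 b0 a'0 b'0 rmorph0 mulr0 addr0 eqxx.
have: 0 < hermform A z.
  rewrite (hermform_diag _ dA).
  have [i Pzi] : exists i, (P *m z) i 0 != 0.
    apply/existsP; rewrite -negb_forall; apply: contraNN zN0 => /forallP h.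
    rewrite -(mulKmx (unitarymx_unit uP) z); apply/eqP.
    suff -> : P *m z = 0 by rewrite mulmx0.
    by apply/colP => i; rewrite [RHS]mxE; move: (h i); rewrite /= ?negbK => /eqP.
  have ge0 j : 0 <= rc (r j) * `|(P *m z) j 0| ^+ 2.
    have [->|/rpos rj] := eqVneq j i0; first by rewrite z0 normr0 expr0n mulr0.
    by rewrite mulr_ge0 ?exprn_ge0 // ler0c ltW.
  rewrite (bigD1 i) //= ltr_wpDr ?sumr_ge0 // mulr_gt0 ?exprn_gt0 ?normr_gt0 //.
  rewrite ltcR rpos //.
  by apply: contraNneq Pzi => ->; rewrite z0.
rewrite zE hermformE // ltcR.
have [le1|lt1 _] := lerP (mxform A (a *: x + b *: y)) 0; last by exists a, b.
by move=> h; exists a', b'; lra.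
Qed.

(** Two eigenvectors with nonpositive eigenvalues have a nontrivial combination killed by the
    complexified [l]. Its real and imaginary parts lie in the hyperplane and their values have a
    nonpositive sum, so both vanish, against the independence of the eigenvectors. *)
Lemma count_of_hyperplane n (A : 'M[R]_n) (P : 'M[C]_n) (r : 'I_n -> R)
    (l : 'cV[R]_n -> R) :
  A^T = A -> P \is unitarymx ->
  map_mx rc A = P ^t* *m diag_mx (\row_i rc (r i)) *m P ->
  scalar l -> (forall x, x != 0 -> l x = 0 -> 0 < mxform A x) ->
  (#|[pred i | (r i <= 0)%R]| <= 1)%N.
Proof.
move=> symA uP dA lin pos; rewrite leqNgt; apply/negP => /card_gt1P[i [j [ri rj ij]]].
rewrite !inE in ri rj.
pose u k : 'cV[C]_n := P ^t* *m delta_mx k 0.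
pose U k := map_mx (@complex.Re R) (u k); pose V k := map_mx (@complex.Im R) (u k).
have uE k : u k = map_mx rc (U k) + 'i *: map_mx rc (V k).
  by apply/matrixP => s t; rewrite !mxE -complexiE -complexE.
have linE a x b y : l (a *: x + b *: y) = a * l x + b * l y.
  have l0 : l 0 = 0 by have := lin (-1) 0 0; rewrite scaler0 addr0 mulN1r addNr.
  by rewrite lin -[b *: y]addr0 lin l0 addr0.
have PuE k : P *m u k = delta_mx k 0.
  by rewrite mulmxA -invmx_unitary // mulmxV ?unitarymx_unit // mul1mx.
clearbody u.
pose L k : C := rc (l (U k)) + 'i%C * rc (l (V k)).
have [al [be [nz z0]]] : exists al be : C, (al != 0) || (be != 0) /\
    al * L i + be * L j = 0.
  have [x0|x0] := eqVneq (L i) 0.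
    by exists 1, 0; rewrite oner_eq0 x0 mulr0 mul0r addr0.
  by exists (L j), (- L i); rewrite oppr_eq0 x0 orbT; split=> //; ring.
pose z := al *: u i + be *: u j.
pose a := complex.Re al; pose a' := complex.Im al.
pose b := complex.Re be; pose b' := complex.Im be.
(* The real and imaginary parts of [z]; the coefficients 1 and - 1 stay explicit so that [linE]
   applies. *)
pose x := 1 *: (a *: U i + b *: U j) + (- 1) *: (a' *: V i + b' *: V j).
pose y := 1 *: (a *: V i + b *: V j) + 1 *: (a' *: U i + b' *: U j).
have zE : z = map_mx rc x + 'i *: map_mx rc y.
  apply/matrixP => s t; rewrite /z !{1}[in LHS]mxE !{1}mxE -complexiE.
  rewrite /a /a' /b /b'; case: (al) => p p'; case: (be) => q q'.
  case: (u i s t) => v v'; case: (u j s t) => w w'; apply/eqP.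
  rewrite eq_complex /=; apply/andP; split; apply/eqP; ring.
have lxy : l x = 0 /\ l y = 0.
  move/eqP: z0; rewrite /L {1}(complexE al) {1}(complexE be) -/a -/b -/a' -/b'.
  rewrite /x /y !linE => h.
  move: h; rewrite eq_complex /= => /andP[/eqP h /eqP h']; split; lra.
have Pz : P *m z = al *: delta_mx i 0 + be *: delta_mx j 0.
  by rewrite mulmxDr -!scalemxAr !PuE.
have : hermform A z <= 0.
  rewrite (hermform_diag _ dA) Pz sumr_le0 // => k _.
  rewrite !mxE !andbT; have [->|ki] := eqVneq k i.
    by rewrite mulr_le0_ge0 ?exprn_ge0 // lecR.
  have [->|kj] := eqVneq k j; first by rewrite mulr_le0_ge0 ?exprn_ge0 // lecR.
  by rewrite !mulr0 addr0 normr0 expr0n mulr0.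
rewrite zE hermformE // lecR => le0.
have nn w : l w = 0 -> 0 <= mxform A w.
  have [->|w0 lw] := eqVneq w 0; last by rewrite ltW ?pos.
  by rewrite /mxform mulmx0 mxE.
have [lx ly] := lxy.
have x0 : x = 0.
  apply/eqP/negPn/negP => x0; have := pos _ x0 lx; have := nn _ ly; lra.
have y0 : y = 0.
  apply/eqP/negPn/negP => y0; have := pos _ y0 ly; have := nn _ lx; lra.
move: Pz; rewrite zE x0 y0 !map_mx0 scaler0 addr0 mulmx0 => /colP Pz.
have := Pz i; have := Pz j; rewrite !mxE !eqxx (negPf ij) eq_sym (negPf ij) /=.
rewrite !mulr0 !mulr1 add0r addr0 => be0 al0.
by move: nz; rewrite -al0 -be0 eqxx.
Qed.


End Spectral.

(** * Quadratic forms on the functions on the vertices *)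

Section Forms.
Variable R : rcfType.
Local Open Scope ring_scope.

Definition vsum (T : finType) (x : T -> R) : R := \sum_v x v.

(** The form x^T (1/2 - A) x, on functions of vertices rather than columns, so that unions and joins
    split it without reindexing. The double sum counts each edge twice. *)
Definition qform (G : sgraph) (x : G -> R) : R :=
  2^-1 * (\sum_v x v ^+ 2) - \sum_u \sum_v (adj u v)%:R * (x u * x v).

(* [bform x] = x^T (3/2 + A') x, where A' is the adjacency matrix of the complement. *)
Definition bform (G : sgraph) (x : G -> R) : R := qform x + vsum x ^+ 2.

Definition lin_indep (T : finType) (x y : T -> R) : Prop :=
  forall a b, (forall v, a * x v + b * y v = 0) -> a = 0 /\ b = 0.

(* Weaker than [hyperplane_pos]. Deriving only this from lambda_2 < 1/2 makes it unnecessary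
   to descend the top eigenvector from R[i] to R. *)
Definition plane_pos (G : sgraph) : Prop :=
  forall x y : G -> R, lin_indep x y ->
  exists a b, 0 < qform (fun v => a * x v + b * y v).

Definition hyperplane_pos (G : sgraph) : Prop :=
  exists l : G -> R, forall x : G -> R, (exists v, x v != 0) ->
  vsum (fun v => l v * x v) = 0 -> 0 < qform x.

(** The failure of positive definiteness, given by a witness that can be extended along embeddings;
    a degenerate form is included. *)
Definition bform_neg (G : sgraph) : Prop :=
  exists2 x : G -> R, (exists v, x v != 0) & bform x <= 0.

Lemma eq_vsum (T : finType) (x y : T -> R) : x =1 y -> vsum x = vsum y.
Proof. by move=> xy; apply: eq_bigr. Qed.

Lemma eq_qform (G : sgraph) (x y : G -> R) : x =1 y -> qform x = qform y.
Proof.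
move=> xy; rewrite /qform; congr (_ * _ - _).
  by apply: eq_bigr => v _; rewrite xy.
by apply: eq_bigr => u _; apply: eq_bigr => v _; rewrite !xy.
Qed.

Lemma eq_bform (G : sgraph) (x y : G -> R) : x =1 y -> bform x = bform y.
Proof. by move=> xy; rewrite /bform (eq_qform xy) (eq_vsum xy). Qed.

Lemma vsumD (T : finType) (x y : T -> R) a b :
  vsum (fun v => a * x v + b * y v) = a * vsum x + b * vsum y.
Proof. by rewrite /vsum big_split -!mulr_sumr. Qed.

Lemma vsumZ (T : finType) (x : T -> R) a :
  vsum (fun v => a * x v) = a * vsum x.
Proof. by rewrite /vsum -mulr_sumr. Qed.

Lemma qformZ (G : sgraph) (x : G -> R) a :
  qform (fun v => a * x v) = a ^+ 2 * qform x.
Proof.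
have -> : qform (fun v => a * x v) = 2^-1 * \sum_v a ^+ 2 * x v ^+ 2
    - \sum_u \sum_v a ^+ 2 * ((adj u v)%:R * (x u * x v)).
  rewrite /qform; congr (_ * _ - _); first by apply: eq_bigr => v _; ring.
  by apply: eq_bigr => u _; apply: eq_bigr => v _; ring.
rewrite -mulr_sumr; under [X in _ - X]eq_bigr => u _ do rewrite -mulr_sumr.
by rewrite -mulr_sumr /qform; ring.
Qed.

Lemma bformZ (G : sgraph) (x : G -> R) a :
  bform (fun v => a * x v) = a ^+ 2 * bform x.
Proof. by rewrite /bform qformZ vsumZ; ring. Qed.

Lemma adjmx_sym (G : sgraph) : (adjmx R G)^T = adjmx R G.
Proof. by apply/matrixP => i j; rewrite !mxE adj_sym. Qed.

Lemma sum_enum_val (T : finType) (F : T -> R) :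
  \sum_v F v = \sum_(i < #|T|) F (enum_val i).
Proof.
rewrite (reindex (@enum_val T predT)) //=.
by exists enum_rank => v _; rewrite ?enum_valK ?enum_rankK.
Qed.

Lemma mxform_qform (G : sgraph) (x : 'cV[R]_#|G|) :
  mxform ((1 / 2)%:M - adjmx R G) x = qform (fun v => x (enum_rank v) 0).
Proof.
rewrite /mxform mulmxBr mulmxBl mul_mx_scalar -scalemxAl.
rewrite /qform (sum_enum_val (fun v => x (enum_rank v) 0 ^+ 2)).
rewrite (sum_enum_val (fun u => \sum_v _)) [LHS]mxE.
congr (_ + _).
  rewrite !mxE !mulr_sumr; apply: eq_bigr => i _.
  by rewrite !mxE enum_valK expr2 mul1r.
rewrite !mxE; congr (- _); rewrite [RHS](eq_bigr (fun i => \sum_(j < #|G|)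
  (adjmx R G) i j * (x i 0 * x j 0))); last first.
  move=> i _; rewrite (sum_enum_val (fun v => (adj (enum_val i) v)%:R *
    (x (enum_rank (enum_val i)) 0 * x (enum_rank v) 0))).
  apply: eq_bigr => j _.
  by rewrite !mxE !enum_valK.
rewrite exchange_big; apply: eq_bigr => j _; rewrite !mxE mulr_suml.
apply: eq_bigr => i _; rewrite !mxE; ring.
Qed.

Lemma plane_pos_eigval2 (G : sgraph) : (2 <= #|G|)%N ->
  eigval R 2 G < 1 / 2 -> plane_pos G.
Proof.
move=> G2; have [P [r [uP dA chiE]]] := symmetric_diagonalization (adjmx_sym G).
rewrite (eigval2_lt _ G2 chiE) => cnt x y indep.
have symA : ((1 / 2)%:M - adjmx R G)^T = (1 / 2)%:M - adjmx R G.
  by rewrite linearB /= tr_scalar_mx adjmx_sym.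
(* The index of the only eigenvalue that may reach 1/2, or an arbitrary index if none does. *)
have [i0 i0P] : exists i0, forall i, i != i0 -> 0 < 1 / 2 - r i.
  have [i0 i0P|h] := pickP [pred i | 1 / 2 <= r i]; last first.
    have i0 : 'I_#|G| by exists 0%N; apply: ltnW.
    exists i0 => i _; move: (h i) => /= /negbT; rewrite -ltNge; lra.
  exists i0 => i ii0; rewrite subr_gt0 ltNge; apply: contraNN ii0 => hi.
  by apply/eqP; move/card_le1_eqP: cnt; apply.
pose X : 'cV[R]_#|G| := \col_i x (enum_val i).
pose Y : 'cV[R]_#|G| := \col_i y (enum_val i).
have XY a b : a *: X + b *: Y = 0 -> a = 0 /\ b = 0.
  move=> /colP h; apply: indep => v; have := h (enum_rank v).
  by rewrite !mxE enum_rankK.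
have [a [b pos]] := plane_pos_of_count symA uP (unitary_shift (1/2) uP dA) i0P XY.
exists a, b; rewrite mxform_qform in pos.
by rewrite (eq_qform (y := fun v => (a *: X + b *: Y) (enum_rank v) 0)) // => v;
  rewrite !mxE enum_rankK.
Qed.

Lemma eigval2_hyperplane_pos (G : sgraph) : (2 <= #|G|)%N ->
  hyperplane_pos G -> eigval R 2 G < 1 / 2.
Proof.
move=> G2 [l lP]; have [P [r [uP dA chiE]]] := symmetric_diagonalization (adjmx_sym G).
rewrite (eigval2_lt _ G2 chiE).
have symA : ((1 / 2)%:M - adjmx R G)^T = (1 / 2)%:M - adjmx R G.
  by rewrite linearB /= tr_scalar_mx adjmx_sym.
pose L (x : 'cV[R]_#|G|) := vsum (fun v => l v * x (enum_rank v) 0).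
have Llin : scalar L.
  move=> a x y; rewrite -[L y]mul1r -vsumD.
  by apply: eq_vsum => v; rewrite !mxE; ring.
have := count_of_hyperplane symA uP (unitary_shift (1/2) uP dA) Llin.
rewrite (eq_card (B := [pred i | (1 / 2 <= r i)%R])).
  apply=> x x0 Lx; rewrite mxform_qform; apply: lP => //.
  have [i xi] : exists i, x i 0 != 0.
    apply/existsP; rewrite -negb_forall; apply: contraNN x0 => /forallP h.
    by apply/eqP/colP => i; rewrite mxE; apply/eqP.
  by exists (enum_val i); rewrite enum_valK.
by move=> i; rewrite !inE subr_le0.
Qed.

End Forms.

(** * Embeddings, joins and unions *)

(** Embedding as an induced subgraph: non-adjacency is preserved as well. *)
Definition emb (H G : sgraph) : Prop :=
  exists2 f : H -> G, injective f & {mono f : x y / adj x y}.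

Lemma giso_emb G H : giso G H -> emb G H.
Proof. by case=> f /bij_inj injf fP; exists f. Qed.

Lemma giso_refl G : giso G G.
Proof. by exists id => //; exists id. Qed.

Lemma giso_sym G H : giso G H -> giso H G.
Proof.
case=> f [g fK gK] fP; exists g; first by exists f.
by move=> x y; rewrite -fP !gK.
Qed.

Lemma giso_trans H G K : giso G H -> giso H K -> giso G K.
Proof.
case=> f bf fP [g bg gP]; exists (g \o f); first exact: bij_comp.
by move=> x y /=; rewrite gP fP.
Qed.

Lemma emb_trans H G K : emb G H -> emb H K -> emb G K.
Proof.
case=> f bf fP [g bg gP]; exists (g \o f); first exact: inj_comp.
by move=> x y /=; rewrite gP fP.
Qed.

Definition sum_map (A B A' B' : Type) (f : A -> A') (g : B -> B') (u : A + B) :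
  A' + B' := match u with inl x => inl (f x) | inr y => inr (g y) end.

Lemma sum_map_bij (A B A' B' : Type) (f : A -> A') (g : B -> B') :
  bijective f -> bijective g -> bijective (sum_map f g).
Proof.
move=> [f' fK f'K] [g' gK g'K]; exists (sum_map f' g').
  by case=> x /=; rewrite ?fK ?gK.
by case=> x /=; rewrite ?f'K ?g'K.
Qed.

Lemma sum_map_inj (A B A' B' : Type) (f : A -> A') (g : B -> B') :
  injective f -> injective g -> injective (sum_map f g).
Proof. by move=> injf injg [x|x] [y|y] //= [] => [/injf|/injg] ->. Qed.

Lemma giso_join G H G' H' : giso G G' -> giso H H' -> giso (G :\/: H) (G' :\/: H').
Proof.
case=> f bf fP [g bg gP]; exists (sum_map f g); first exact: sum_map_bij.
by case=> x [] y //=; rewrite ?fP ?gP.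
Qed.

Lemma giso_union G H G' H' : giso G G' -> giso H H' -> giso (G :+: H) (G' :+: H').
Proof.
case=> f bf fP [g bg gP]; exists (sum_map f g); first exact: sum_map_bij.
by case=> x [] y //=; rewrite ?fP ?gP.
Qed.

Lemma emb_join G H G' H' : emb G G' -> emb H H' -> emb (G :\/: H) (G' :\/: H').
Proof.
case=> f bf fP [g bg gP]; exists (sum_map f g); first exact: sum_map_inj.
by case=> x [] y //=; rewrite ?fP ?gP.
Qed.

Lemma emb_union G H G' H' : emb G G' -> emb H H' -> emb (G :+: H) (G' :+: H').
Proof.
case=> f bf fP [g bg gP]; exists (sum_map f g); first exact: sum_map_inj.
by case=> x [] y //=; rewrite ?fP ?gP.
Qed.

Lemma emb_joinl G H : emb G (G :\/: H).
Proof. by exists inl => // x y []. Qed.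

Lemma emb_joinr G H : emb H (G :\/: H).
Proof. by exists inr => // x y []. Qed.

Lemma emb_unionr G H : emb H (G :+: H).
Proof. by exists inr => // x y []. Qed.

Lemma gjoinC G H : giso (G :\/: H) (H :\/: G).
Proof.
pose f A B (u : A + B) : B + A := match u with inl x => inr x | inr y => inl y end.
exists (f G H); last by case=> x [].
by exists (f H G); case.
Qed.

Lemma gjoinA G H K : giso (G :\/: (H :\/: K)) (G :\/: H :\/: K).
Proof.
pose f (u : G + (H + K)) : G + H + K :=
  match u with inl x => inl (inl x) | inr (inl y) => inl (inr y)
             | inr (inr z) => inr z end.
pose g (u : G + H + K) : G + (H + K) :=
  match u with inl (inl x) => inl x | inl (inr y) => inr (inl y)
             | inr z => inr (inr z) end.
exists f; first by exists g; do ?case.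
by do ![case=> [?|]|move=> ?].
Qed.

Lemma gunionA G H K : giso (G :+: (H :+: K)) (G :+: H :+: K).
Proof.
pose f (u : G + (H + K)) : G + H + K :=
  match u with inl x => inl (inl x) | inr (inl y) => inl (inr y)
             | inr (inr z) => inr z end.
pose g (u : G + H + K) : G + (H + K) :=
  match u with inl (inl x) => inl x | inl (inr y) => inr (inl y)
             | inr z => inr (inr z) end.
exists f; first by exists g; do ?case.
by do ![case=> [?|]|move=> ?].
Qed.

Lemma gjoin0g (G H : sgraph) : #|G| = 0 -> giso (G :\/: H) H.
Proof.
move/card0_eq => G0.
have F (x : G) : False by have := G0 x.
pose f (u : G + H) : H := match u with inl x => False_rect _ (F x) | inr y => y end.
exists f; last by case=> [x|x] [y|y] //; case: (F _).
by exists inr => // [[x|//]]; case: (F x).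
Qed.

Lemma giso0 (G H : sgraph) : #|G| = 0 -> #|H| = 0 -> giso G H.
Proof.
move=> G0 H0; apply: giso_trans (gjoin0g _ G0).
by apply: giso_trans (giso_sym (gjoin0g G H0)) (gjoinC _ _).
Qed.

(** * Extension by zero, and the forms of joins and unions *)

Section Extension.
Variable R : rcfType.
Local Open Scope ring_scope.

(** Extension by zero along an injective [f]; summing over the fibre avoids choosing a preimage. *)
Definition extend (A B : finType) (f : A -> B) (x : A -> R) (v : B) : R :=
  \sum_(u | f u == v) x u.

Lemma extend_val (A B : finType) (f : A -> B) x u :
  injective f -> extend f x (f u) = x u.
Proof.
by move=> injf; rewrite /extend (big_pred1 u) // => v; rewrite inj_eq.
Qed.

Lemma extend_out (A B : finType) (f : A -> B) x v :
  v \notin codom f -> extend f x v = 0.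
Proof.
move=> vf; rewrite /extend big_pred0 // => u; apply: contraNF vf => /eqP <-.
exact: codom_f.
Qed.

Lemma sum_codom (A B : finType) (f : A -> B) (F : B -> R) : injective f ->
  (forall v, v \notin codom f -> F v = 0) -> \sum_v F v = \sum_u F (f u).
Proof.
move=> injf F0; rewrite [RHS](partition_big f predT) //=.
apply: eq_bigr => v _; have [/codomP[u ->]|vf] := boolP (v \in codom f).
  by rewrite (big_pred1 u) // => w; rewrite inj_eq.
rewrite F0 // big_pred0 // => u; apply: contraNF vf => /eqP <-.
exact: codom_f.
Qed.

Lemma vsum_extend (A B : finType) (f : A -> B) x :
  injective f -> vsum (extend f x) = vsum x.
Proof.
move=> injf; rewrite /vsum (sum_codom injf) => [|v vf]; last exact: extend_out.
by apply: eq_bigr => u _; rewrite extend_val.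
Qed.

Lemma qform_extend (H G : sgraph) (f : H -> G) (x : H -> R) :
  injective f -> {mono f : u v / adj u v} -> qform (extend f x) = qform x.
Proof.
move=> injf fP; rewrite /qform (sum_codom injf) => [|v vf]; last first.
  by rewrite extend_out // expr0n.
congr (_ * _ - _); first by apply: eq_bigr => u _; rewrite extend_val.
rewrite (sum_codom injf) => [|u uf]; last first.
  by rewrite big1 // => v _; rewrite (extend_out _ uf) mul0r mulr0.
apply: eq_bigr => u _; rewrite (sum_codom injf) => [|v vf]; last first.
  by rewrite (extend_out _ vf) !mulr0.
by apply: eq_bigr => v _; rewrite fP !extend_val.
Qed.

Lemma extendD (A B : finType) (f : A -> B) x y a b v :
  a * extend f x v + b * extend f y v = extend f (fun u => a * x u + b * y u) v.
Proof. by rewrite /extend !mulr_sumr -big_split. Qed.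

Lemma plane_pos_emb (H G : sgraph) : emb H G -> plane_pos R G -> plane_pos R H.
Proof.
case=> f injf fP pG x y xy.
have [a b h|a [b ab]] := pG (extend f x) (extend f y).
  by apply: xy => u; have := h (f u); rewrite !extend_val.
by exists a, b; move: ab; rewrite (eq_qform (extendD f x y a b)) qform_extend.
Qed.

Lemma extend_neq0 (A B : finType) (f : A -> B) x : injective f ->
  (exists u, x u != 0) -> exists v, extend f x v != 0.
Proof. by move=> injf [u xu]; exists (f u); rewrite extend_val. Qed.

Lemma bform_neg_emb (H G : sgraph) : emb H G -> bform_neg R H -> bform_neg R G.
Proof.
case=> f injf fP [x x0 xneg]; exists (extend f x); first exact: extend_neq0.
by rewrite /bform qform_extend ?vsum_extend.
Qed.

Lemma hyperplane_pos_emb (H G : sgraph) : emb H G ->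
  hyperplane_pos R G -> hyperplane_pos R H.
Proof.
case=> f injf fP [l lP]; exists (l \o f) => x x0 lx.
rewrite -(qform_extend x injf fP); apply: lP; first exact: extend_neq0.
rewrite -lx /vsum (sum_codom injf) => [|v vf]; last by rewrite extend_out ?mulr0.
by apply: eq_bigr => u _; rewrite extend_val.
Qed.

Lemma vsum_sum (A B : finType) (x : A + B -> R) :
  vsum x = vsum (x \o inl) + vsum (x \o inr).
Proof. by rewrite /vsum big_sumType. Qed.

Lemma adj_sumE (b : bool) (G H : sgraph) (x : G + H -> R) :
  \sum_u \sum_v (sum_rel b u v)%:R * (x u * x v) =
  \sum_u \sum_v (adj u v)%:R * (x (inl u) * x (inl v))
  + \sum_u \sum_v (adj u v)%:R * (x (inr u) * x (inr v))
  + 2 * b%:R * (vsum (x \o inl) * vsum (x \o inr)).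
Proof.
have sE (A B : finType) (f : A -> R) (g : B -> R) :
    \sum_u \sum_v b%:R * (f u * g v) = b%:R * (vsum f * vsum g).
  rewrite /vsum mulr_suml mulr_sumr; apply: eq_bigr => u _.
  by rewrite mulr_sumr mulr_sumr.
rewrite big_sumType /=; under eq_bigr => u _ do rewrite big_sumType /=.
under [X in _ + X]eq_bigr => u _ do rewrite big_sumType /=.
rewrite !big_split /= (sE _ _ (x \o inl) (x \o inr)) (sE _ _ (x \o inr) (x \o inl)).
by ring.
Qed.

Lemma qform_join (G H : sgraph) (x : (G :\/: H)%G -> R) :
  qform x = qform (x \o inl) + qform (x \o inr)
            - 2 * (vsum (x \o inl) * vsum (x \o inr)).
Proof. by rewrite /qform adj_sumE big_sumType /=; ring. Qed.

Lemma qform_union (G H : sgraph) (x : (G :+: H)%G -> R) :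
  qform x = qform (x \o inl) + qform (x \o inr).
Proof. by rewrite /qform adj_sumE big_sumType /=; ring. Qed.

(** The square of the total cancels the cross term of [qform_join]; this decoupling is the reason
    for working with [bform]. *)
Lemma bform_join (G H : sgraph) (x : (G :\/: H)%G -> R) :
  bform x = bform (x \o inl) + bform (x \o inr).
Proof. by rewrite /bform qform_join vsum_sum; ring. Qed.

Lemma bform_union (G H : sgraph) (x : (G :+: H)%G -> R) :
  bform x = bform (x \o inl) + bform (x \o inr)
            + 2 * (vsum (x \o inl) * vsum (x \o inr)).
Proof. by rewrite /bform qform_union vsum_sum; ring. Qed.

Lemma vsum1 (x : ('K_1)%G -> R) : vsum x = x ord0.
Proof. by rewrite /vsum big_ord1. Qed.

Lemma qform1 (x : ('K_1)%G -> R) : qform x = 2^-1 * x ord0 ^+ 2.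
Proof. by rewrite /qform !big_ord1 adj_irr mul0r subr0. Qed.

Lemma bform1 (x : ('K_1)%G -> R) : bform x = 3 / 2 * x ord0 ^+ 2.
Proof. by rewrite /bform qform1 vsum1; field. Qed.

End Extension.

(** * Forbidden subgraphs and the value of a graph *)

(** The pair [b], [c] is left free: the four vertices induce P_4 if it is an edge and 2 K_2
    otherwise. *)
Definition P4_2K2_free (G : sgraph) : Prop :=
  forall a b c d : G, adj a b -> adj c d ->
  ~~ adj a c -> ~~ adj a d -> ~~ adj b d -> False.

Lemma P4_2K2_free_emb H G : emb H G -> P4_2K2_free G -> P4_2K2_free H.
Proof.
case=> f _ fP freeG a b c d; rewrite -!fP; exact: freeG.
Qed.

Section Pullback.
Variables (T : finType) (G : sgraph) (f : T -> G).

Definition pullback_rel : rel T := fun x y => adj (f x) (f y).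

Fact pullback_sym : symmetric pullback_rel.
Proof. by move=> x y; rewrite /pullback_rel adj_sym. Qed.

Fact pullback_irr : irreflexive pullback_rel.
Proof. by move=> x; rewrite /pullback_rel adj_irr. Qed.

Definition pullback := SGraph pullback_sym pullback_irr.

Lemma pullback_emb : injective f -> emb pullback G.
Proof. by move=> injf; exists f. Qed.

End Pullback.

Lemma inj_surj_bij (A B : finType) (f : A -> B) :
  injective f -> (forall y, exists x, f x == y) -> bijective f.
Proof.
move=> injf surj; exists (fun y => xchoose (surj y)) => [x|y].
  by apply: injf; apply/eqP/(xchooseP (surj (f x))).
by apply/eqP/(xchooseP (surj y)).
Qed.

(* At a vertex of minimum degree, all neighbours are adjacent to all non-neighbours. *)
Lemma cone_join_decomposition (G : sgraph) : P4_2K2_free G -> 0 < #|G| ->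
  exists G1 G2 : sgraph, [/\ giso G (('K_1 :+: G1) :\/: G2),
    #|G1| < #|G|, #|G2| < #|G|, P4_2K2_free G1 & P4_2K2_free G2].
Proof.
move=> freeG /card_gt0P[v0 _].
pose deg (v : G) := #|[set u | adj v u]|.
have [v _ vmin] := arg_minnP deg (isT : predT v0).
pose S := [pred u | (u != v) && ~~ adj v u]; pose T := [pred u : G | adj v u].
have ST a b : a \in S -> b \in T -> adj a b.
  rewrite !inE => /andP[av va] vb; apply/negPn/negP => ab.
  (* Since [b] is a neighbour of [v] and not of [a], minimality of the degree of [v] gives [a] a
     neighbour [c] that is not one of [v]. The edges [v b] and [c a] are then forbidden. *)
  have [c ca vc] : exists2 c, adj a c & ~~ adj v c.
    have /subsetPn[c] : ~~ ([set u | adj a u] \subset [set u | adj v u]).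
      apply/negP => sub; have := vmin a isT; rewrite leqNgt => /negP; apply.
      rewrite proper_card // properE sub; apply/subsetPn; exists b; rewrite ?inE //.
    by rewrite !inE => ac vc; exists c.
  by apply: (freeG v b c a); rewrite // adj_sym.
pose G1 := pullback (val : {u | u \in S} -> G).
pose G2 := pullback (val : {u | u \in T} -> G).
have emb1 : emb G1 G by apply/pullback_emb/val_inj.
have emb2 : emb G2 G by apply/pullback_emb/val_inj.
exists G1, G2; split; try exact: P4_2K2_free_emb freeG; last 2 first.
- rewrite /= card_sig; apply: proper_card; apply/properP; split.
    exact/subset_predT.
  by exists v; rewrite // !inE eqxx.
- rewrite /= card_sig; apply: proper_card; apply/properP; split.
    exact/subset_predT.
  by exists v; rewrite // !inE adj_irr.
apply: giso_sym.
pose f (u : ('I_1 + {u | u \in S}) + {u | u \in T}) : G := match u with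
  inl (inl _) => v | inl (inr s) => val s | inr t => val t end.
exists f; last first.
  move=> [[i|[a /= aS]]|[a /= aT]] [[j|[b /= bS]]|[b /= bT]] //=; rewrite ?adj_irr.
  - by rewrite (ord1 i) (ord1 j).
  - by move: bS; rewrite inE => /andP[_ /negPf].
  - by move: aS; rewrite inE adj_sym => /andP[_ /negPf].
  - exact: ST.
  - by rewrite adj_sym.
  - by rewrite adj_sym ST.
apply: inj_surj_bij.
  move=> [[i|[a aS]]|[a aT]] [[j|[b bS]]|[b bT]] //= E.
  - by rewrite (ord1 i) (ord1 j).
  - by exfalso; move: (bS); rewrite -E inE eqxx.
  - by exfalso; move: (bT); rewrite -E inE adj_irr.
  - by exfalso; move: (aS); rewrite E inE eqxx.
  - by congr inl; congr inr; apply: val_inj.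
  - by exfalso; move: (aS) (bT); rewrite !inE E => /andP[_ /negPf->].
  - by exfalso; move: (aT); rewrite E inE adj_irr.
  - by exfalso; move: (aT) (bS); rewrite !inE E => -> /andP[].
  - by congr inr; apply: val_inj.
move=> y; have [->|yv] := eqVneq y v; first by exists (inl (inl ord0)).
have [vy|vy] := boolP (adj v y).
  have yT : y \in T by rewrite inE.
  by exists (inr (exist _ y yT)) => /=.
have yS : y \in S by rewrite inE yv vy.
by exists (inl (inr (exist _ y yS))) => /=.
Qed.

Section Values.
Variable R : rcfType.
Local Open Scope ring_scope.

(** On the combinations of the indicators of the two edges with coefficients [al] and [be], the form
    is - al^2 - be^2, or - (al + be)^2 when [b c] is an edge. *)
Lemma plane_pos_P4_2K2_free (G : sgraph) : plane_pos R G -> P4_2K2_free G.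
Proof.
move=> pG a b c d ab cd nac nad nbd.
have [ac ad] : a != c /\ a != d.
  split; apply/eqP => E; first by move: nad; rewrite E cd.
  by move: nac; rewrite E adj_sym cd.
have [bc bd] : b != c /\ b != d.
  split; apply/eqP => E; first by move: nac; rewrite -E ab.
  by move: nad; rewrite -E ab.
have neq x y : adj x y -> x != y :> G by apply: contraTneq => ->; rewrite adj_irr.
pose f (i : 'I_4) := nth a [:: a; b; c; d] i.
have injf : injective f.
  move=> i j /eqP; rewrite /f nth_uniq // => [/eqP/val_inj //|].
  by rewrite /= !inE !negb_or neq // ac ad bc bd neq.
have [|al [be]] := plane_pos_emb (pullback_emb injf) pG
    (x := fun i : 'I_4 => (i < 2)%:R) (y := fun i : 'I_4 => (2 <= i)%N%:R).
  move=> al be h; have := h ord0; have := h ord_max; rewrite /=.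
  by rewrite !mulr0 !mulr1 add0r addr0.
apply/negP; rewrite -leNgt /qform !big_ord_recl !big_ord0 /= /pullback_rel /f /=.
rewrite !adj_irr (adj_sym b a) (adj_sym c a) (adj_sym d a) (adj_sym c b).
rewrite (adj_sym d b) (adj_sym d c) ab cd (negPf nac) (negPf nad) (negPf nbd).
have := sqr_ge0 (al + be); have := sqr_ge0 al; have := sqr_ge0 be.
case: (adj b c) => /=; nra.
Qed.

(** The cross term 2 s s' is at most F B' + F' B by the inequality of arithmetic and geometric
    means; comparing squares avoids roots. *)
Lemma cauchy_add (s s' F F' B B' : R) : 0 <= F -> 0 <= F' -> 0 <= B -> 0 <= B' ->
  s ^+ 2 <= F * B -> s' ^+ 2 <= F' * B' -> (s + s') ^+ 2 <= (F + F') * (B + B').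
Proof.
move=> F0 F'0 B0 B'0 h h'.
suff: 2 * (s * s') <= F * B' + F' * B by lra.
have X0 : 0 <= F * B' + F' * B by rewrite addr_ge0 ?mulr_ge0.
have := ler_pM (sqr_ge0 s) (sqr_ge0 s') h h'.
have := sqr_ge0 (F * B' - F' * B).
move=> h1 h2; rewrite leNgt; apply/negP => lt.
have : (F * B' + F' * B) ^+ 2 < (2 * (s * s')) ^+ 2 by rewrite ltr_sqr ?nnegrE //; lra.
nra.
Qed.

(* When [bform] is positive definite with matrix B, its value is F = 1^T B^-1 1; the optimal
   vector B^-1 1 attains equality in the Cauchy-Schwarz bound. *)
Definition has_value (G : sgraph) (F : R) : Prop :=
  [/\ forall x : G -> R, (exists v, x v != 0) -> 0 < bform x,
      forall x : G -> R, vsum x ^+ 2 <= F * bform x &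
      exists2 w : G -> R, vsum w = F & bform w = F].

Lemma vsum0 (T : finType) (x : T -> R) : (forall v, x v = 0) -> vsum x = 0.
Proof. by move=> x0; rewrite /vsum big1. Qed.

Lemma bform0 (G : sgraph) (x : G -> R) : (forall v, x v = 0) -> bform x = 0.
Proof.
move=> x0; rewrite (eq_bform (y := fun v => 0 * x v)) => [|v].
  by rewrite bformZ expr0n mul0r.
by rewrite mul0r.
Qed.

Lemma eq0_or_neq0 (T : finType) (x : T -> R) :
  (forall v, x v = 0) \/ (exists v, x v != 0).
Proof.
have [/existsP ?|] := boolP [exists v, x v != 0]; first by right.
by rewrite negb_exists => /forallP h; left => v; apply/eqP; rewrite -[_ == _]negbK.
Qed.

Lemma bform_ge0 (G : sgraph) F (x : G -> R) : has_value G F -> 0 <= bform x.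
Proof.
case=> pos _ _; have [/bform0->//|/pos/ltW//] := eq0_or_neq0 x.
Qed.

Lemma value_ge0 (G : sgraph) F : has_value G F -> 0 <= F.
Proof. by move=> vG; have [_ _ [w _ <-]] := vG; apply: bform_ge0 vG. Qed.

Lemma value_giso G H F : giso G H -> has_value H F -> has_value G F.
Proof.
move=> GH [pos le [w wF bF]].
have [f injf fP] := giso_emb GH; have [g injg gP] := giso_emb (giso_sym GH).
split=> [x x0|x|].
- by rewrite /bform -(qform_extend x injf fP) -(vsum_extend x injf); apply/pos/extend_neq0.
- by rewrite /bform -(qform_extend x injf fP) -(vsum_extend x injf); apply: le.
by exists (extend g w); rewrite /bform ?qform_extend // vsum_extend.
Qed.

Lemma value_empty (G : sgraph) : #|G| = 0%N -> has_value G 0.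
Proof.
move/card0_eq => G0; have noG (x : G) : False by have := G0 x.
have z (x : G -> R) v : x v = 0 by case: (noG v).
split=> [x [v]|x|]; first by case: (noG v).
  by rewrite vsum0 // expr0n mul0r.
by exists (fun=> 0); [apply: vsum0 | apply: bform0].
Qed.

Definition sum_fun (A B : Type) (x : A -> R) (y : B -> R) (u : A + B) : R :=
  match u with inl v => x v | inr v => y v end.

Lemma neq0_sum (A B : finType) (x : A + B -> R) : (exists v, x v != 0) ->
  (exists v, (x \o inl) v != 0) \/ (exists v, (x \o inr) v != 0).
Proof. by case=> [[v|v] xv]; [left | right]; exists v. Qed.

Lemma value_join G H F F' : has_value G F -> has_value H F' ->
  has_value (G :\/: H) (F + F').
Proof.
move=> vG vH; have F0 := value_ge0 vG; have F'0 := value_ge0 vH.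
have [posG leG [w wF bF]] := vG; have [posH leH [w' wF' bF']] := vH.
split=> [x x0|x|].
- rewrite bform_join; have [xl|xr] := neq0_sum x0.
    by rewrite ltr_wpDr ?(bform_ge0 _ vH) ?posG.
  by rewrite ltr_wpDl ?(bform_ge0 _ vG) ?posH.
- rewrite bform_join vsum_sum.
  have := leG (x \o inl); have := leH (x \o inr).
  have := bform_ge0 (x \o inl) vG; have := bform_ge0 (x \o inr) vH.
  by move=> *; apply: cauchy_add.
exists (sum_fun w w'); rewrite ?bform_join ?vsum_sum.
  by rewrite -[X in _ = X + _]wF -wF'.
by rewrite -[X in _ = X + _]bF -bF'.
Qed.

Lemma value_cone G F : has_value G F -> F < 3 / 2 ->
  has_value ('K_1 :+: G) ((2 - F) / (3 - 2 * F)).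
Proof.
move=> vG F32; have F0 := value_ge0 vG; have [pos le [w wF bF]] := vG.
split=> [x x0|x|].
- rewrite bform_union bform1 vsum1; set a := (x \o inl) ord0.
  have [y0|/[dup] yn0 /pos By] := eq0_or_neq0 (x \o inr).
    rewrite (vsum0 y0) (bform0 y0); have: a != 0.
      by case: x0 => -[v|v]; rewrite /a /= ?(ord1 v) // -[x _]/((x \o inr) v) y0 eqxx.
    by move=> a0; have : 0 < a ^+ 2 by [rewrite exprn_even_gt0]; lra.
  (* The form is (3 a + 2 s)^2 / 6 + (B - 2 s^2 / 3), and s^2 <= F B < 3 B / 2. *)
  have := le (x \o inr); have := sqr_ge0 (3 * a + 2 * vsum (x \o inr)).
  have : F * bform (x \o inr) < 3 / 2 * bform (x \o inr) by rewrite ltr_pM2r.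
  move: (bform _) (vsum _) => B s; nra.
- rewrite bform_union vsum_sum bform1 !vsum1; set a := (x \o inl) ord0.
  have := le (x \o inr); have := bform_ge0 (x \o inr) vG.
  move: (bform _) (vsum _) => B s B0 sB.
  rewrite mulrAC ler_pdivlMr; last by lra.
  have [Fp|] := ltrP 0 F; last first.
    move=> Fn; have {Fn F0}F0 : F = 0 by apply/eqP; rewrite eq_le Fn.
    have /eqP : s ^+ 2 == 0 by rewrite eq_le sqr_ge0 (le_trans sB) ?F0 ?mul0r.
    move/eqP; rewrite sqrf_eq0 => /eqP ->; rewrite F0; nra.
  (* After multiplication by F the right side exceeds the left by (2 - F) (F B - s^2) + (F a + 2 (F
     - 1) s)^2 / 2. *)
  rewrite -(ler_pM2l Fp); have := sqr_ge0 (F * a + 2 * (F - 1) * s).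
  have : 0 <= (2 - F) * (F * B - s ^+ 2) by rewrite mulr_ge0 ?subr_ge0 //; lra.
  nra.
have d0 : 3 - 2 * F != 0 by apply/eqP; lra.
(* The vector B^-1 1 of the cone: the new vertex gets a with 3 a / 2 + (1 - a) F = 1, and the old
   ones get (1 - a) w. *)
exists (sum_fun (fun=> 2 * (1 - F) / (3 - 2 * F)) (fun v => 1 / (3 - 2 * F) * w v)).
  rewrite vsum_sum vsum1 /= (vsumZ w) wF; by field.
by rewrite bform_union bform1 vsum1 /= (vsumZ w) (bformZ w) wF bF; field.
Qed.

End Values.

(** * Normal forms of the graphs with positive definite [bform] *)

#[local] Instance giso_equivalence : Equivalence giso.
Proof.
by split; [exact: giso_refl | exact: giso_sym | move=> ? ? ?; exact: giso_trans].
Qed.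

#[local] Instance gjoin_proper : Proper (giso ==> giso ==> giso) gjoin.
Proof. by move=> G G' GG' H H' HH'; exact: giso_join. Qed.

#[local] Instance gunion_proper : Proper (giso ==> giso ==> giso) gunion.
Proof. by move=> G G' GG' H H' HH'; exact: giso_union. Qed.

Lemma gjoinCA G H K : giso (G :\/: (H :\/: K)) (H :\/: (G :\/: K)).
Proof. by rewrite gjoinA (gjoinC G) -gjoinA; reflexivity. Qed.

Lemma gjoing0 (G H : sgraph) : #|H| = 0 -> giso (G :\/: H) G.
Proof. by move=> H0; rewrite gjoinC gjoin0g //; reflexivity. Qed.

Lemma gjoin0K G : giso ('K_0 :\/: G) G.
Proof. by apply: gjoin0g; rewrite card_ord. Qed.

Lemma gjoinK0 G : giso (G :\/: 'K_0) G.
Proof. by apply: gjoing0; rewrite card_ord. Qed.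

Local Notation edgeless m := (gcompl (complete m)).

Definition edgeless_join (ms : seq nat) : sgraph :=
  gjoins [seq edgeless m | m <- ms].

(** The complement consists of [p] paws, [q] paths P_3 and one clique for each entry of [ms]. *)
Definition normal_form (p q : nat) (ms : seq nat) : sgraph :=
  join_copies p ('K_1 :+: 'K_(1, 2)) :\/: join_copies q ('K_1 :+: 'K_(1, 1))
  :\/: edgeless_join ms.

Lemma join_copiesD p q G :
  giso (join_copies (p + q) G) (join_copies p G :\/: join_copies q G).
Proof.
elim: p => [|p IH]; first by rewrite gjoin0K; reflexivity.
rewrite -[join_copies (p.+1 + q) G]/(G :\/: join_copies (p + q) G)%G IH gjoinA.
reflexivity.
Qed.

Lemma edgeless_join_cat ms ms' :
  giso (edgeless_join (ms ++ ms')) (edgeless_join ms :\/: edgeless_join ms').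
Proof.
elim: ms => [|m ms IH]; first by rewrite gjoin0K; reflexivity.
rewrite -[edgeless_join ((m :: ms) ++ ms')]/(edgeless m :\/: edgeless_join (ms ++ ms'))%G.
by rewrite IH gjoinA; reflexivity.
Qed.

Lemma edgeless_join_perm ms ms' : perm_eq ms ms' ->
  giso (edgeless_join ms) (edgeless_join ms').
Proof.
elim: ms ms' => [|m ms IH] ms' E; first by move: E; rewrite perm_sym => /perm_nilP ->; reflexivity.
have /splitPr E' : m \in ms' by rewrite -(perm_mem E) mem_head.
case: E' E => s1 s2 E.
have {}E : perm_eq ms (s1 ++ s2).
  by rewrite -(perm_cons m) (perm_trans E) // -cat1s perm_catCA.
rewrite -[edgeless_join (m :: ms)]/(edgeless m :\/: edgeless_join ms)%G (IH _ E).
rewrite !edgeless_join_cat gjoinCA; reflexivity.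
Qed.

Lemma gjoinACA G H K L :
  giso (G :\/: H :\/: (K :\/: L)) (G :\/: K :\/: (H :\/: L)).
Proof. by rewrite -!gjoinA (gjoinCA H); reflexivity. Qed.

Lemma normal_form_join p q ms p' q' ms' :
  giso (normal_form p q ms :\/: normal_form p' q' ms')
       (normal_form (p + p') (q + q') (ms ++ ms')).
Proof.
rewrite /normal_form edgeless_join_cat !join_copiesD.
rewrite gjoinACA (gjoinACA (join_copies p _)); reflexivity.
Qed.

Lemma edgelessS m : giso ('K_1 :+: edgeless m) (edgeless m.+1).
Proof.
have adj0 n (i j : edgeless n) : adj i j = false.
  by rewrite /adj /= /compl_rel /= /complete_rel andbN.
exists (@unsplit 1 m); first exact: Bijective (@unsplitK 1 m) (@splitK 1 m).
move=> [i|i] [j|j]; rewrite [LHS]adj0 //; last exact/esym/adj0.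
by rewrite (ord1 i) (ord1 j) adj_irr.
Qed.

Lemma edgeless1 : giso 'K_1 (edgeless 1).
Proof.
exists id; first by exists id.
by move=> i j; rewrite (ord1 i) (ord1 j) !adj_irr.
Qed.

Section Values.
Variable R : rcfType.
Local Open Scope ring_scope.

(* The value of the edgeless graph on [m] vertices, whose complement is [K_m]. *)
Definition weight (m : nat) : R := 2 * m%:R / (2 * m%:R + 1).

Lemma weightE m : weight m = 1 - (2 * m%:R + 1)^-1.
Proof.
have m0 : 0 <= m%:R :> R by rewrite ler0n.
by rewrite /weight; field; apply/eqP; lra.
Qed.

Lemma weight_mono m n : (m <= n)%N -> weight m <= weight n.
Proof.
rewrite -(ler_nat R) => mn; rewrite !weightE lerB // lef_pV2 ?posrE.
- by lra.
- by have := ler0n R n; lra.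
by have := ler0n R m; lra.
Qed.

Lemma weight_lt1 m : weight m < 1.
Proof. by rewrite weightE; have := ler0n R m; rewrite gtrBl invr_gt0; lra. Qed.

Lemma weight1 : weight 1 = 2 / 3. Proof. by rewrite /weight; field. Qed.
Lemma weight2 : weight 2 = 4 / 5. Proof. by rewrite /weight; field. Qed.
Lemma weight3 : weight 3 = 6 / 7. Proof. by rewrite /weight; field. Qed.
Lemma weight4 : weight 4 = 8 / 9. Proof. by rewrite /weight; field. Qed.

(** The complement is a clique, built by adding dominating vertices: the recursion of [value_cone]
    sends [weight m] to [weight m.+1], and the weights stay below 1. *)
Lemma value_edgeless m : has_value (edgeless m) (weight m).
Proof.
elim: m => [|m IH].
  by rewrite /weight mulr0 mul0r; apply: value_empty; rewrite /= card_ord.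
apply: value_giso (giso_sym (edgelessS m)) _.
have w1 := weight_lt1 m; have := value_cone IH.
have -> : (2 - weight m) / (3 - 2 * weight m) = weight m.+1.
  rewrite /weight -natr1; have m0 := ler0n R m.
  by field; rewrite ?andbT; apply/andP; split; apply/eqP; lra.
by apply; lra.
Qed.

Lemma value_join_copies p G (F : R) : has_value G F ->
  has_value (join_copies p G) (p%:R * F).
Proof.
move=> vG; elim: p => [|p IH].
  by rewrite mul0r; apply: value_empty; rewrite /= card_ord.
rewrite -natr1 mulrDl mul1r addrC; exact: value_join.
Qed.

Lemma value_edgeless_join ms :
  has_value (edgeless_join ms) (\sum_(m <- ms) weight m).
Proof.
elim: ms => [|m ms IH].
  by rewrite big_nil; apply: value_empty; rewrite /= card_ord.
rewrite big_cons; apply: value_join => //; exact: value_edgeless.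
Qed.

(* The complements of these two graphs are P_3 and the paw. *)
Lemma value_P3 : has_value ('K_1 :+: 'K_(1, 1)) (2 : R).
Proof.
have := value_cone (value_join (value_edgeless 1) (value_edgeless 1)).
rewrite (_ : (2 - _) / _ = 2); first by apply; rewrite weight1; lra.
by rewrite weight1; field.
Qed.

Lemma value_paw : has_value ('K_1 :+: 'K_(1, 2)) (8 : R).
Proof.
have := value_cone (value_join (value_edgeless 1) (value_edgeless 2)).
rewrite (_ : (2 - _) / _ = 8); first by apply; rewrite weight1 weight2; lra.
by rewrite weight1 weight2; field.
Qed.

Definition normal_value (p q : nat) (ms : seq nat) : R :=
  8 * p%:R + 2 * q%:R + \sum_(m <- ms) weight m.

Lemma value_normal_form p q ms :
  has_value (normal_form p q ms) (normal_value p q ms).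
Proof.
rewrite /normal_value (mulrC 8) (mulrC 2).
apply: value_join (value_edgeless_join ms).
exact: value_join (value_join_copies p value_paw) (value_join_copies q value_P3).
Qed.

Lemma sum_weight_ge ms : all (ltn 0) ms ->
  2 / 3 * (size ms)%:R <= \sum_(m <- ms) weight m.
Proof.
elim: ms => [|m ms IH] /=; first by rewrite big_nil mulr0.
case/andP=> m0 /IH{}IH; rewrite big_cons -natr1.
have := weight_mono m0; rewrite weight1; lra.
Qed.

(** A value below 3/2 leaves no room for a paw (8), a P_3 (2) or three edgeless factors (at least
    2/3 each). With two factors, 4/5 + 4/5 and 2/3 + 6/7 are too large, so the sizes are 1, 1 or 1,
    2, and the cones are the complements of P_3 and of the paw. With at most one factor the cone is
    edgeless. *)
Lemma cone_normal_form p q ms : all (ltn 0) ms -> normal_value p q ms < 3 / 2 ->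
  exists p' q' ms', all (ltn 0) ms' /\
    giso ('K_1 :+: normal_form p q ms) (normal_form p' q' ms').
Proof.
move=> ms0; rewrite /normal_value; have := sum_weight_ge ms0.
case: p => [|p]; last first.
  have := ler0n R p; have := ler0n R q; have := ler0n R (size ms).
  by rewrite -[p.+1%:R]natr1 => *; exfalso; lra.
case: q => [|q]; last first.
  by have := ler0n R q; have := ler0n R (size ms); rewrite -[q.+1%:R]natr1 => *; exfalso; lra.
have nf00 l : giso (normal_form 0 0 l) (edgeless_join l).
  by rewrite /normal_form gjoinK0 gjoin0K; reflexivity.
case: ms ms0 => [|m [|n [|k ms]]] ms0.
- exists 0%N, 0%N, [:: 1%N]; split=> //; rewrite !nf00.
  by rewrite /edgeless_join /= gjoinK0 -edgelessS; apply: giso_union;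
    [reflexivity | apply: giso0; rewrite ?card_ord].
- exists 0%N, 0%N, [:: m.+1]; split=> //; rewrite !nf00 /edgeless_join /= !gjoinK0.
  exact: edgelessS.
- move: ms0 => /=; rewrite big_cons big_seq1 => /and3P[m0 n0 _] _ lt.
  have wm := weight_mono m0; have wn := weight_mono n0; rewrite weight1 in wm wn.
  have mn : giso ('K_1 :+: normal_form 0 0 [:: m; n]) ('K_1 :+: 'K_(m, n)).
    by rewrite nf00 /edgeless_join /= gjoinK0; reflexivity.
  wlog : m n m0 n0 lt wm wn mn / (m <= n)%N.
    move=> W; case: (leqP m n) => [|/ltnW] h; first exact: (W m n).
    have mn' : giso ('K_1 :+: normal_form 0 0 [:: n; m]) ('K_1 :+: 'K_(n, m)).
      by rewrite nf00 /edgeless_join /= gjoinK0; reflexivity.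
    have lt' := lt; rewrite [weight m + _]addrC in lt'.
    have [p' [q' [ms' [ms'0 I]]]] := W n m n0 m0 lt' wn wm mn' h.
    exists p', q', ms'; split=> //; rewrite mn gjoinC -mn'; exact: I.
  move=> lemn; case: (leqP 2 m) => m2.
    have := weight_mono m2; have := weight_mono (leq_trans m2 lemn).
    by rewrite weight2 => *; exfalso; lra.
  have {m2 m0} m1 : m = 1%N by lia.
  case: (leqP 3 n) => n3; first by have := weight_mono n3; rewrite weight3 => *; exfalso; lra.
  case: n n0 n3 lemn lt wn mn => [|[|[|]]] // _ _ _ _ _; rewrite m1 => mn.
    exists 0%N, 1%N, [::]; split=> //; rewrite mn /normal_form !gjoinK0 gjoin0K.
    by rewrite /join_copies /= gjoinK0; reflexivity.
  exists 1%N, 0%N, [::]; split=> //; rewrite mn /normal_form !gjoinK0.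
  by rewrite /join_copies /= gjoinK0; reflexivity.
rewrite /= -[(size ms).+3%:R]natr1 -[(size ms).+2%:R]natr1 -[(size ms).+1%:R]natr1.
by have := ler0n R (size ms) => *; exfalso; lra.
Qed.

Lemma cone_bform_neg G (F : R) : has_value G F -> 3 / 2 <= F ->
  bform_neg R ('K_1 :+: G).
Proof.
case=> _ _ [w wF bF] F32.
(* With [w] fixed and a at the new vertex, the form is 3 a^2 / 2 + 2 a F + F, least at a = - 2 F /
   3, where it equals F - 2 F^2 / 3. *)
exists (sum_fun (fun=> - (2 / 3) * F) w); first by exists (inl ord0) => /=; nra.
by rewrite bform_union bform1 vsum1 /= wF bF; nra.
Qed.

Lemma normal_form_or_neg (G : sgraph) : P4_2K2_free G ->
  (exists p q ms, all (ltn 0) ms /\ giso G (normal_form p q ms))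
  \/ bform_neg R G.
Proof.
have [n] := ubnP #|G|; elim: n G => // n IH G Gn freeG.
have [G0|G0] := posnP #|G|.
  left; exists 0%N, 0%N, [::]; split=> //; apply: giso0 => //.
  by rewrite !card_sum !card_ord.
have [G1 [G2 [GE ltG1 ltG2 free1 free2]]] := cone_join_decomposition freeG G0.
have [|[p2 [q2 [ms2 [ms20 E2]]]]|neg] := IH G2 _ free2; last 1 first.
- right; apply: bform_neg_emb neg; apply: emb_trans (emb_joinr _ _) _.
  exact/giso_emb/giso_sym/GE.
- exact: leq_trans ltG2 _.
have [|[p1 [q1 [ms1 [ms10 E1]]]]|neg] := IH G1 _ free1; last 1 first.
- right; apply: bform_neg_emb neg; apply: emb_trans (emb_unionr _ _) _.
  by apply: emb_trans (emb_joinl _ _) _; exact/giso_emb/giso_sym/GE.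
- exact: leq_trans ltG1 _.
have [lt|ge] := ltrP (normal_value p1 q1 ms1) (3 / 2).
  have [p [q [ms [ms0 E]]]] := cone_normal_form ms10 lt.
  left; exists (p + p2)%N, (q + q2)%N, (ms ++ ms2).
  by rewrite all_cat ms0 ms20 GE E1 E E2 normal_form_join; split; [|reflexivity].
right; apply: bform_neg_emb (cone_bform_neg (value_normal_form _ _ _) ge).
by apply: emb_trans (emb_joinl _ G2) _; apply/giso_emb; rewrite GE E1; reflexivity.
Qed.

End Values.

(** * Graphs with a component of the complement that is not positive definite *)

Section Planes.
Variable R : rcfType.
Local Open Scope ring_scope.

Lemma qform_le_bform (G : sgraph) (x : G -> R) : qform x <= bform x.
Proof. by rewrite /bform lerDl sqr_ge0. Qed.

(** The two witnesses, extended by zero, span a plane on which [bform], and hence the smaller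
    [qform], is nonpositive. So at most one component of the complement can fail to be positive
    definite. *)
Lemma bform_neg_join (G H : sgraph) : bform_neg R G -> bform_neg R H ->
  ~ plane_pos R (G :\/: H).
Proof.
move=> [x [u xu] xneg] [y [v yv] yneg] pos.
have [a b E|a [b]] := pos (sum_fun x (fun=> 0)) (sum_fun (fun=> 0) y).
  have := E (inl u); have := E (inr v); rewrite /= !mulr0 addr0 add0r.
  by move=> /eqP + /eqP; rewrite !mulf_eq0 (negPf xu) (negPf yv) !orbF => /eqP + /eqP.
apply/negP; rewrite -leNgt; apply: le_trans (qform_le_bform _) _.
rewrite bform_join (eq_bform (y := fun w => a * x w)) => [|w]; last first.
  by rewrite /= mulr0 addr0.
rewrite [X in _ + X](eq_bform (y := fun w => b * y w)) => [|w]; last first.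
  by rewrite /= mulr0 add0r.
by rewrite !bformZ; have := sqr_ge0 a; have := sqr_ge0 b; nra.
Qed.

(* The plane is spanned by a vector [x] on [G] with [bform x <= 0] and the vector equal to 2 at
   the isolated vertex and 1 at the joined one. *)
Lemma bform_neg_cone (G : sgraph) : bform_neg R G ->
  ~ plane_pos R (('K_1 :+: G) :\/: 'K_1).
Proof.
move=> [x [u xu] xneg] pos.
have [a b E|a [b]] := pos (sum_fun (sum_fun (fun=> 0) x) (fun=> 0))
    (sum_fun (sum_fun (fun=> 2) (fun=> 0)) (fun=> 1)).
  have := E (inl (inr u)); have := E (inr ord0); rewrite /= !mulr0 addr0 add0r mulr1.
  by move=> b0 /eqP; rewrite mulf_eq0 (negPf xu) orbF => /eqP.
apply/negP; rewrite -leNgt qform_join qform_union vsum_sum !qform1 !vsum1 /=.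
rewrite (eq_qform (y := fun w => a * x w)) => [|w]; last by rewrite /= mulr0 addr0.
rewrite (eq_vsum (y := fun w => a * x w)) => [|w]; last by rewrite /= mulr0 addr0.
rewrite qformZ vsumZ; move: xneg; rewrite /bform.
have := sqr_ge0 (a * vsum x + b); have := sqr_ge0 a; have := sqr_ge0 b.
move: (qform x) (vsum x) => q s; nra.
Qed.

(* On the vectors (a, c w, e z), with w and z optimal, put k = 2 F - 3. The plane is spanned by
   (- 2 F, 3, 0), where [qform] is negative, and (2 k + 2 F, - 3, 3 k), which represents the
   total with respect to [bform]. *)
Lemma cone_join_necessary (G H : sgraph) (F K : R) :
  has_value G F -> has_value H K -> 3 / 2 <= F -> 0 < K ->
  plane_pos R (('K_1 :+: G) :\/: H) -> K * (2 * F - 3) < F - 1.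
Proof.
move=> [_ _ [w wF bF]] [_ _ [z zK bK]] F32 K0 pos; rewrite ltNge; apply/negP => le.
(* At F = 3/2 the assumption [le] would read F - 1 <= 0. *)
have k0 : 0 < 2 * F - 3 by rewrite lt0r; apply/andP; split; [apply/eqP => k0; nra | lra].
pose k := 2 * F - 3; have kp : 0 <= k by exact: ltW.
have [a b E|a [b]] := pos
    (sum_fun (sum_fun (fun=> - 2 * F) (fun v => 3 * w v)) (fun=> 0))
    (sum_fun (sum_fun (fun=> 2 * k + 2 * F) (fun v => - 3 * w v)) (fun v => 3 * k * z v)).
  have b0 : b = 0.
    have: vsum (fun v => b * (3 * k) * z v) = 0.
      by apply: vsum0 => v; rewrite -[RHS](E (inr v)) /=; ring.
    rewrite vsumZ zK -mulrA => /eqP; rewrite mulf_eq0 => /orP[/eqP//|/eqP h].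
    by exfalso; have := mulr_gt0 k0 K0; rewrite -/k; lra.
  split=> //; have := E (inl (inl ord0)); rewrite /= b0 mul0r addr0 => /eqP.
  by rewrite mulf_eq0 => /orP[/eqP//|/eqP h]; exfalso; lra.
apply/negP; rewrite -leNgt qform_join qform_union vsum_sum !qform1 !vsum1 /=.
have wE : (fun v => a * (3 * w v) + b * (- 3 * w v)) =1 (fun v => (3 * (a - b)) * w v).
  by move=> v; ring.
have zE : (fun v => a * 0 + b * (3 * k * z v)) =1 (fun v => (3 * k * b) * z v).
  by move=> v; ring.
rewrite (eq_qform (y := fun v => (3 * (a - b)) * w v)) //.
rewrite (eq_vsum (y := fun v => (3 * (a - b)) * w v)) //.
rewrite (eq_qform (y := fun v => (3 * k * b) * z v)) //.
rewrite (eq_vsum (y := fun v => (3 * k * b) * z v)) //.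
rewrite !qformZ !vsumZ wF zK.
have -> : qform w = F - F ^+ 2 by move: bF; rewrite /bform wF; lra.
have -> : qform z = K - K ^+ 2 by move: bK; rewrite /bform zK; lra.
(* By [le] this is nonnegative, and the form on the plane is minus a sum of squares with
   coefficients built from d, k and F. *)
pose d := k * K - F + 1.
have d0 : 0 <= d by rewrite /d /k; lra.
set q := (X in X <= 0).
have -> : q = - ((3 * d * b + F * a) ^+ 2 + 9 * k * d * b ^+ 2 + 3 * F * k * a ^+ 2).
  by rewrite /q /d /k; field.
have := sqr_ge0 (3 * d * b + F * a).
have : 0 <= 9 * k * d * b ^+ 2 by rewrite mulr_ge0 ?sqr_ge0 // !mulr_ge0.
have : 0 <= 3 * F * k * a ^+ 2 by rewrite mulr_ge0 ?sqr_ge0 // !mulr_ge0 //; lra.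
lra.
Qed.

(** The computation behind [cone_join_sufficient]: [a] is the entry at the cone vertex, [s] and [B]
    are the total and [bform] on G, [r] and [B'] those on H, and the linear equation defines the
    hyperplane. On it, F times the whole total is - k s, so the point is to bound s. *)
Lemma cone_join_ineq (F K a s r B B' : R) (k := 2 * F - 3) :
  3 / 2 <= F -> 0 <= K -> K * k < F - 1 -> 0 <= B -> 0 <= B' ->
  s ^+ 2 <= F * B -> r ^+ 2 <= K * B' -> F * a + (k + F) * s + F * r = 0 ->
  [|| a != 0, 0 < B | 0 < B'] ->
  0 < 2^-1 * a ^+ 2 + (B - s ^+ 2) + (B' - r ^+ 2) - 2 * ((a + s) * r).
Proof.
move=> F32 K0 lt B0 B'0 sB rB' l0 nz; have F0 : 0 < F by lra.
have k0 : 0 <= k by rewrite /k; lra.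
(* A completes the square in 3 a^2 / 2 + 2 a s. *)
pose A := a + 2 / 3 * s; pose X := 3 / 2 * A ^+ 2 + B'; pose m := 3 * k + F.
have m0 : 0 < m by rewrite /m; lra.
have X0 : 0 <= X by have := sqr_ge0 A; rewrite /X; lra.
set q := (X in 0 < X).
have qX : F ^+ 2 * X - s ^+ 2 * (k * m) / 3 + F * (F * B - s ^+ 2) = F ^+ 2 * q.
  have -> : q = 3 / 2 * a ^+ 2 + 2 * a * s + B + B' - (a + s + r) ^+ 2.
    by rewrite /q; field.
  have tE : F * (a + s + r) = - (k * s) by lra.
  by rewrite [RHS]mulrBr -exprMn tE /X /A /m /k; field.
(* Cauchy-Schwarz for A + r, a single vertex having value 2/3; the hyperplane equation gives 3 F (A
   + r) = - m s. *)
have cs : m ^+ 2 * s ^+ 2 <= (2 / 3 + K) * (9 * F ^+ 2 * X).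
  have Ar : 3 * F * (A + r) = - (m * s) by rewrite /A /m; lra.
  have h : (A + r) ^+ 2 <= (2 / 3 + K) * X.
    by apply: cauchy_add => //; have := sqr_ge0 A; lra.
  have -> : m ^+ 2 * s ^+ 2 = (3 * F) ^+ 2 * (A + r) ^+ 2.
    by rewrite -[RHS]exprMn Ar; ring.
  have -> : (2 / 3 + K) * (9 * F ^+ 2 * X) = (3 * F) ^+ 2 * ((2 / 3 + K) * X) by ring.
  by rewrite ler_wpM2l ?sqr_ge0.
have FX : 0 <= F * (F * B - s ^+ 2) by rewrite mulr_ge0 ?subr_ge0 // ltW.
have F2 : 0 < F ^+ 2 by rewrite exprn_gt0.
rewrite -(pmulr_rgt0 _ F2) -qX.
(* This is the hypothesis K k < F - 1, rescaled. *)
have km : 3 * k * (2 / 3 + K) < m by rewrite /m /k in lt *; lra.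
have [Xp|Xn] := ltrP 0 X.
  suff : s ^+ 2 * (k * m) < 3 * (F ^+ 2 * X) by lra.
  rewrite -(ltr_pM2l m0).
  have F2X : 0 < F ^+ 2 * X by rewrite mulr_gt0.
  have := ler_wpM2l k0 cs.
  have : 3 * (3 * k * (2 / 3 + K)) * (F ^+ 2 * X) < 3 * m * (F ^+ 2 * X).
    by rewrite ltr_pM2r // ltr_pM2l.
  by lra.
(* Here s, a and B' all vanish, so [nz] leaves B > 0. *)
have XE : X = 0 by apply/eqP; rewrite eq_le Xn.
have s0 : s = 0.
  apply/eqP; rewrite -sqrf_eq0 eq_le sqr_ge0 andbT.
  rewrite XE !mulr0 in cs; by rewrite -(pmulr_rle0 _ (exprn_gt0 2 m0)).
have A20 : A ^+ 2 = 0 by have := sqr_ge0 A; rewrite /X in XE; lra.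
have a0 : a = 0.
  by move/eqP: A20; rewrite sqrf_eq0 /A s0 mulr0 addr0 => /eqP.
have B'E : B' = 0 by rewrite /X A20 in XE; lra.
move: nz; rewrite a0 B'E eqxx ltxx orbF /= => Bp.
by rewrite XE s0 expr0n /= !mul0r mulr0 subr0 add0r subr0 !mulr_gt0.
Qed.

(* The hyperplane is orthogonal, with respect to [qform], to the negative vector (- 2 F, 3 w, 0)
   with w optimal on [G]. *)
Lemma cone_join_sufficient (G H : sgraph) (F K : R) :
  has_value G F -> has_value H K -> 3 / 2 <= F -> K * (2 * F - 3) < F - 1 ->
  hyperplane_pos R (('K_1 :+: G) :\/: H).
Proof.
move=> vG vH F32 lt; have K0 := value_ge0 vH.
have [posG leG _] := vG; have [posH leH _] := vH; pose k := 2 * F - 3.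
exists (sum_fun (sum_fun (fun=> F) (fun=> k + F)) (fun=> F)) => x x0.
rewrite !vsum_sum !vsum1 /=.
rewrite (eq_vsum (y := fun v => (k + F) * x (inl (inr v)))) //.
rewrite [X in _ + X](eq_vsum (y := fun v => F * x (inr v))) //.
rewrite !vsumZ qform_join qform_union vsum_sum vsum1 qform1 /=.
set a := x (inl (inl ord0)).
pose y v := x (inl (inr v)); pose z v := x (inr v).
rewrite -[vsum ((x \o inl) \o inr)]/(vsum y) -[vsum (x \o inr)]/(vsum z).
rewrite -[qform ((x \o inl) \o inr)]/(qform y) -[qform (x \o inr)]/(qform z).
rewrite -[vsum (fun v => x (inl (inr v)))]/(vsum y) -[vsum (fun v => x (inr v))]/(vsum z).
have qE (L : sgraph) (u : L -> R) : qform u = bform u - vsum u ^+ 2.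
  by rewrite /bform addrK.
rewrite !qE => l0; apply: (cone_join_ineq F32 K0 lt) => //.
- exact: bform_ge0 vG.
- exact: bform_ge0 vH.
case: x0 => -[[v|v]|v] xv.
- by move: xv; rewrite (ord1 v) => xv; rewrite xv.
- by rewrite posG ?orbT //; exists v.
by rewrite posH ?orbT //; exists v.
Qed.

Lemma posdef_hyperplane_pos (G : sgraph) (F : R) :
  has_value G F -> hyperplane_pos R G.
Proof.
case=> pos _ _; exists (fun=> 1) => x x0; rewrite vsumZ mul1r => s0.
by have := pos _ x0; rewrite /bform s0 expr0n addr0.
Qed.

(** Induction splitting off one component of the complement at a time. A cone over a graph that is
    not positive definite tolerates no further vertex, by [bform_neg_cone]; this gives the third
    outcome, which connectedness will exclude. *)
Lemma plane_pos_structure (G : sgraph) : plane_pos R G ->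
  [\/ exists p q ms, all (ltn 0) ms /\ giso G (normal_form p q ms),
      exists p1 q1 ms1 p2 q2 ms2,
        [/\ all (ltn 0) ms1, all (ltn 0) ms2, 3 / 2 <= normal_value R p1 q1 ms1 &
         giso G (('K_1 :+: normal_form p1 q1 ms1) :\/: normal_form p2 q2 ms2)] |
      exists2 G1, giso G ('K_1 :+: G1) & bform_neg R G1].
Proof.
have [n] := ubnP #|G|; elim: n G => // n IH G Gn posG.
have freeG := plane_pos_P4_2K2_free posG.
have [G0|G0] := posnP #|G|.
  apply: Or31; exists 0%N, 0%N, [::]; split=> //; apply: giso0 => //.
  by rewrite !card_sum !card_ord.
have [G1 [G2 [GE ltG1 ltG2 free1 free2]]] := cone_join_decomposition freeG G0.
have posGE := plane_pos_emb (giso_emb (giso_sym GE)) posG.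
have [cone|neg1] := normal_form_or_neg R free1; last first.
  have [G20|/card_gt0P[z _]] := posnP #|G2|.
    by apply: Or33; exists G1 => //; rewrite GE gjoing0 //; reflexivity.
  (* A single vertex of [G2] serves as the joined vertex. *)
  exfalso; apply: (bform_neg_cone neg1); apply: plane_pos_emb posGE.
  apply: emb_join; first exact/giso_emb/giso_refl.
  exists (fun=> z) => [i j _|i j]; first by rewrite (ord1 i) (ord1 j).
  by rewrite (ord1 i) (ord1 j) !adj_irr.
have [p1 [q1 [ms1 [ms10 E1]]]] := cone.
have [lt|ge] := ltrP (normal_value R p1 q1 ms1) (3 / 2); last first.
  have [[p2 [q2 [ms2 [ms20 E2]]]]|neg2] := normal_form_or_neg R free2.
    apply: Or32; exists p1, q1, ms1, p2, q2, ms2; split=> //.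
    by rewrite GE E1 E2; reflexivity.
  case: (bform_neg_join _ neg2 posGE); apply: bform_neg_emb.
    by apply: emb_union; [exact/giso_emb/giso_refl | exact/giso_emb/giso_sym/E1].
  exact: cone_bform_neg (value_normal_form _ _ _ _) ge.
have [p [q [ms [ms0 E]]]] := cone_normal_form ms10 lt.
have {GE}GE : giso G (normal_form p q ms :\/: G2).
  by rewrite GE E1 E; reflexivity.
have pos2 := plane_pos_emb (emb_joinr _ _) posGE.
case: (IH G2 (leq_trans ltG2 Gn) pos2) => [[p2 [q2 [ms2 [ms20 E2]]]]||].
- apply: Or31; exists (p + p2)%N, (q + q2)%N, (ms ++ ms2).
  by rewrite all_cat ms0 ms20 GE E2 normal_form_join; split; [|reflexivity].
- move=> [p3 [q3 [ms3 [p2 [q2 [ms2 [ms30 ms20 ge E2]]]]]]].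
  apply: Or32; exists p3, q3, ms3, (p + p2)%N, (q + q2)%N, (ms ++ ms2).
  rewrite all_cat ms0 ms20; split=> //.
  by rewrite GE E2 gjoinCA normal_form_join; reflexivity.
(* The roles are exchanged: the vertex joined to [G2] is the isolated vertex of the first factor. *)
move=> [G3 E2 neg3]; exfalso; apply: (bform_neg_cone neg3).
apply: plane_pos_emb posGE; apply: (@emb_trans (('K_1 :+: G3) :\/: ('K_1 :+: G1))).
  apply: emb_join; first exact/giso_emb/giso_refl.
  by exists inl => // i j [].
apply: giso_emb; rewrite gjoinC E2; reflexivity.
Qed.

End Planes.

Lemma connectedg_giso G H : giso G H -> connectedg G -> connectedg H.
Proof.
case=> f [g fK gK] fP conn x y; rewrite -(gK x) -(gK y).
have /connectP[s sP ->] := conn (g x) (g y).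
elim: s (g x) sP => [|a s IH] u //= /andP[ua /IH]; apply: connect_trans.
by apply: connect1; rewrite fP.
Qed.

Lemma connectedg_union (G H : sgraph) : 0 < #|G| -> 0 < #|H| -> ~ connectedg (G :+: H).
Proof.
move=> /card_gt0P[x _] /card_gt0P[y _] /(_ (inl x) (inr y)) /connectP[s].
suff: forall a s, path adj (inl a : (G :+: H)%G) s -> last (inl a) s <> inr y.
  by move=> h /h + E; rewrite -E.
by move=> a {}s; elim: s a => [|[b|b] s IH] a //= /andP[_ /IH].
Qed.

(** * The graphs of the list in normal form *)

Lemma completeS m : giso ('K_1 :\/: 'K_m) 'K_m.+1.
Proof.
exists (@unsplit 1 m); first exact: Bijective (@unsplitK 1 m) (@splitK 1 m).
move=> u v; rewrite [LHS]/adj /= /complete_rel (can_eq (@unsplitK 1 m)).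
by case: u v => [i|i] [j|j] //=; rewrite (ord1 i) (ord1 j) eqxx /= /complete_rel eqxx.
Qed.

Lemma complete_edgeless_join m : giso 'K_m (edgeless_join (nseq m 1)).
Proof.
elim: m => [|m IH]; first reflexivity.
by rewrite -completeS IH edgeless1; reflexivity.
Qed.

Lemma compl_P3 : giso (gcompl 'P_3) ('K_1 :+: 'K_(1, 1)).
Proof.
apply: giso_sym.
(* The middle vertex of the path is isolated in the complement. *)
pose f (u : ('K_1 :+: 'K_(1, 1))%G) : gcompl 'P_3 := match u with
  | inl _ => @Ordinal 3 1 isT
  | inr (inl _) => @Ordinal 3 0 isT
  | inr (inr _) => @Ordinal 3 2 isT end.
exists f; last first.
  move=> [i|[i|i]] [j|[j|j]] //=; rewrite (ord1 i) (ord1 j) ?adj_irr //.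
apply: inj_surj_bij.
  by move=> [i|[i|i]] [j|[j|j]] //= _; rewrite (ord1 i) (ord1 j).
move=> [[|[|[|//]]] h]; [exists (inr (inl ord0)) | exists (inl ord0) | exists (inr (inr ord0))];
  exact/eqP/val_inj.
Qed.

Lemma normal_form00 ms : giso (normal_form 0 0 ms) (edgeless_join ms).
Proof. by rewrite /normal_form gjoinK0 gjoin0K; reflexivity. Qed.

Lemma normal_form0 q ms : giso (normal_form 0 q ms)
  (join_copies q ('K_1 :+: 'K_(1, 1)) :\/: edgeless_join ms).
Proof. by rewrite /normal_form gjoin0K; reflexivity. Qed.

Lemma join_copies1 G : giso (join_copies 1 G) G.
Proof. exact: gjoinK0. Qed.

Lemma edgeless_join1 s : giso (edgeless_join [:: s]) (edgeless s).
Proof. exact: gjoinK0. Qed.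

Lemma edgeless_join_cons s ms :
  giso (edgeless_join (s :: ms)) (edgeless s :\/: edgeless_join ms).
Proof. reflexivity. Qed.

Lemma multipartiteE s a k :
  multipartite s a k = edgeless_join [seq s i | i <- index_iota a k.+1].
Proof. by rewrite /multipartite /edgeless_join -map_comp. Qed.

(** Passes from a list of sizes to a family indexed from [a], as [multipartite] expects. *)
Lemma map_nth_index_iota (ms : seq nat) a :
  [seq nth 0 ms (i - a) | i <- index_iota a (a + size ms)] = ms.
Proof.
rewrite /index_iota addKn -[X in iota X _]addn0 iotaDl -map_comp -[RHS](mkseq_nth 0).
by apply: eq_map => i /=; rewrite addKn.
Qed.

Lemma complete2 : giso 'K_2 'K_(1, 1).
Proof. by rewrite (complete_edgeless_join 2) edgeless_join_cons edgeless_join1; reflexivity. Qed.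

Lemma edgeless2 : giso (edgeless 2) ('K_1 :+: 'K_1).
Proof. by rewrite -edgelessS -edgeless1; reflexivity. Qed.

Lemma edgeless_join_K1 : giso (edgeless_join [:: 1]) 'K_1.
Proof. by rewrite edgeless_join1 -edgeless1; reflexivity. Qed.

Lemma graph1E s : giso ((edgeless 2 :+: 'K_2) :\/: edgeless s)
  (('K_1 :+: normal_form 0 1 [::]) :\/: normal_form 0 0 [:: s]).
Proof.
rewrite normal_form00 edgeless_join1 normal_form0 join_copies1 gjoinK0.
by rewrite edgeless2 complete2 gunionA; reflexivity.
Qed.

Lemma graph2E s : giso (('K_1 :+: (edgeless s :\/: gcompl 'P_3)) :\/: 'K_1)
  (('K_1 :+: normal_form 0 1 [:: s]) :\/: normal_form 0 0 [:: 1]).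
Proof.
rewrite normal_form00 edgeless_join_K1 normal_form0 join_copies1 edgeless_join1.
by rewrite compl_P3 (gjoinC (edgeless s)); reflexivity.
Qed.

Lemma graph3E s : giso (('K_1 :+: (edgeless s :\/: 'K_3)) :\/: 'K_1)
  (('K_1 :+: normal_form 0 0 [:: s; 1; 1; 1]) :\/: normal_form 0 0 [:: 1]).
Proof.
rewrite !normal_form00 edgeless_join_K1 edgeless_join_cons.
by rewrite (complete_edgeless_join 3); reflexivity.
Qed.

Lemma graph4E s :
  giso (('K_1 :+: (edgeless s :\/: edgeless 2 :\/: 'K_2)) :\/: 'K_1)
  (('K_1 :+: normal_form 0 0 [:: s; 2; 1; 1]) :\/: normal_form 0 0 [:: 1]).
Proof.
rewrite !normal_form00 edgeless_join_K1 2!edgeless_join_cons gjoinA.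
have K2 : giso (edgeless_join [:: 1; 1]) 'K_2 := giso_sym (complete_edgeless_join 2).
by rewrite K2; reflexivity.
Qed.

Lemma graph5E s1 s2 s3 t :
  giso (('K_1 :+: (edgeless s1 :\/: edgeless s2 :\/: edgeless s3)) :\/: edgeless t)
  (('K_1 :+: normal_form 0 0 [:: s1; s2; s3]) :\/: normal_form 0 0 [:: t]).
Proof.
rewrite !normal_form00 edgeless_join1 2!edgeless_join_cons edgeless_join1 gjoinA.
reflexivity.
Qed.

Lemma graph6E t : giso (('K_1 :+: 'K_3) :\/: edgeless t)
  (('K_1 :+: normal_form 0 0 [:: 1; 1; 1]) :\/: normal_form 0 0 [:: t]).
Proof.
rewrite !normal_form00 edgeless_join1 (complete_edgeless_join 3); reflexivity.
Qed.

Lemma graph8E t p ms :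
  giso (('K_1 :+: 'K_(1, t)) :\/: join_copies p ('K_1 :+: 'K_(1, 1)) :\/: edgeless_join ms)
  (('K_1 :+: normal_form 0 0 [:: t; 1]) :\/: normal_form 0 p ms).
Proof.
rewrite !normal_form00 normal_form0 edgeless_join_cons edgeless_join1.
by rewrite (gjoinC (edgeless t)) gjoinA; reflexivity.
Qed.

Lemma graph9E ms :
  giso (('K_1 :+: 'K_(1, 3)) :\/: ('K_1 :+: 'K_(1, 2)) :\/: edgeless_join ms)
  (('K_1 :+: normal_form 0 0 [:: 3; 1]) :\/: normal_form 1 0 ms).
Proof.
rewrite !normal_form00 /normal_form join_copies1 gjoinK0 edgeless_join_cons edgeless_join1.
by rewrite (gjoinC (edgeless 3)) gjoinA; reflexivity.
Qed.

Lemma graph10E s :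
  giso (('K_1 :+: 'K_(1, 3)) :\/: ('K_1 :+: 'K_(1, 2)) :\/: ('K_1 :+: 'K_(1, 1))
        :\/: edgeless s)
  (('K_1 :+: normal_form 0 0 [:: 3; 1]) :\/: normal_form 1 1 [:: s]).
Proof.
rewrite !normal_form00 /normal_form !join_copies1 edgeless_join_cons !edgeless_join1.
by rewrite (gjoinC (edgeless 3)) !gjoinA; reflexivity.
Qed.

Lemma graph11E s :
  giso (('K_1 :+: 'K_(2, 2)) :\/: ('K_1 :+: 'K_(1, 1)) :\/: edgeless s)
  (('K_1 :+: normal_form 0 0 [:: 2; 2]) :\/: normal_form 0 1 [:: s]).
Proof.
rewrite !normal_form00 normal_form0 join_copies1 edgeless_join_cons !edgeless_join1.
by rewrite gjoinA; reflexivity.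
Qed.

Lemma graph12E :
  giso (('K_1 :+: 'K_(2, 3)) :\/: ('K_1 :+: 'K_(1, 1)))
  (('K_1 :+: normal_form 0 0 [:: 3; 2]) :\/: normal_form 0 1 [::]).
Proof.
rewrite !normal_form00 normal_form0 join_copies1 edgeless_join_cons !edgeless_join1.
by rewrite gjoinK0 (gjoinC (edgeless 3)); reflexivity.
Qed.

Lemma graph13E a t ms :
  giso (('K_1 :+: 'K_(a, t)) :\/: edgeless_join ms)
  (('K_1 :+: normal_form 0 0 [:: a; t]) :\/: normal_form 0 0 ms).
Proof.
rewrite !normal_form00 edgeless_join_cons !edgeless_join1; reflexivity.
Qed.

Lemma normal_form_perm p q ms ms' : perm_eq ms ms' ->
  giso (normal_form p q ms) (normal_form p q ms').
Proof. by move=> E; rewrite /normal_form (edgeless_join_perm E); reflexivity. Qed.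

(** Each single factor has an isolated vertex, so a connected graph of order at least 2 needs two
    factors. *)
Lemma normal_form_cone p q ms : all (ltn 0) ms -> p + q + size ms = 1 ->
  exists G1, giso (normal_form p q ms) ('K_1 :+: G1).
Proof.
case: p => [|[|p]]; last by [].
  case: q => [|[|q]]; last by [].
    case: ms => [//|[//|m] [|? ?]] //= _ _; exists (edgeless m).
    by rewrite normal_form00 edgeless_join1 edgelessS; reflexivity.
  case: ms => [|? ?] //= _ _; exists ('K_(1, 1))%G.
  by rewrite normal_form0 join_copies1 gjoinK0; reflexivity.
case: q => [|q] //; case: ms => [|? ?] //= _ _; exists ('K_(1, 2))%G.
by rewrite /normal_form join_copies1 !gjoinK0; reflexivity.
Qed.

Lemma connectedg_cone (G G1 : sgraph) : 1 < #|G| -> connectedg G -> ~ giso G ('K_1 :+: G1).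
Proof.
move=> G1' conn E; have cE : #|G| = (1 + #|G1|)%N.
  have [f bf _] := E; rewrite (bij_eq_card bf) card_sum card_ord; reflexivity.
apply: (@connectedg_union 'K_1 G1 _ _ (connectedg_giso E conn)).
  by rewrite card_ord.
by rewrite cE in G1'.
Qed.

(** * Solutions of the inequality between the two values *)

Section Enumeration.
Variable R : rcfType.
Local Open Scope ring_scope.
Local Notation nv := (normal_value R).
Local Notation wt := (weight R).

Lemma normal_value_ge p q ms : all (ltn 0) ms ->
  8 * p%:R + 2 * q%:R + 2 / 3 * (size ms)%:R <= nv p q ms.
Proof. by move=> ms0; rewrite lerD2l sum_weight_ge. Qed.

Lemma sum_weight_le ms : \sum_(m <- ms) wt m <= (size ms)%:R.
Proof.
elim: ms => [|m ms IH] /=; first by rewrite big_nil.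
by rewrite big_cons -natr1; have := weight_lt1 R m; lra.
Qed.

Lemma natr_ge (k n : nat) : (k <= n)%N -> k%:R <= n%:R :> R.
Proof. by rewrite ler_nat. Qed.

Lemma sum_weight_lt1 ms : all (ltn 0) ms -> \sum_(m <- ms) wt m < 1 ->
  (size ms <= 1)%N.
Proof.
move=> ms0; have := sum_weight_ge R ms0; case: leqP => // /natr_ge; lra.
Qed.

Lemma normal_value_lt1 p q ms : all (ltn 0) ms -> (0 < p + q + size ms)%N ->
  nv p q ms < 1 -> exists t, [/\ (0 < t)%N, p = 0%N, q = 0%N & ms = [:: t]].
Proof.
move=> ms0 pos lt; have := normal_value_ge p q ms0.
have := ler0n R p; have := ler0n R q; have := ler0n R (size ms).
move=> n0 q0 p0 ge.
have : (p < 1)%N by rewrite -(ltr_nat R); lra.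
have : (q < 1)%N by rewrite -(ltr_nat R); lra.
have : (size ms < 2)%N by rewrite -(ltr_nat R); lra.
case: p q ms pos ms0 {lt n0 q0 p0 ge} => [|//] [|//] [|t [|? ?]] //= _ /andP[t0 _] _ _ _.
by exists t.
Qed.

(* With F and K the two values, [3 / 2 <= F] and [2 / 3 <= K] force [F < 3]. *)
Lemma admissible_cases p q ms p' q' ms' :
  all (ltn 0) ms -> all (ltn 0) ms' -> sorted geq ms ->
  (0 < p' + q' + size ms')%N -> 3 / 2 <= nv p q ms ->
  nv p' q' ms' * (2 * nv p q ms - 3) < nv p q ms - 1 ->
  p = 0%N /\
  [\/ q = 1%N /\ exists s t, [/\ (0 < t)%N, p' = 0%N, q' = 0%N, ms' = [:: t] &
        ms = [::] \/ (0 < s)%N /\ t = 1%N /\ ms = [:: s]],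
      q = 0%N /\ exists s t, [/\ (0 < t)%N, p' = 0%N, q' = 0%N, ms' = [:: t] & t = 1%N /\
        (ms = [:: s; 1; 1; 1]%N \/ (2 <= s <= 3)%N /\ ms = [:: s; 2; 1; 1]%N)],
      q = 0%N /\ exists s1 s2 s3 t, [/\ (0 < t)%N, p' = 0%N, q' = 0%N, ms' = [:: t] &
        ms = [:: s1; s2; s3]] |
      q = 0%N /\ exists s t, ms = [:: s; t]].
Proof.
move=> ms0 ms'0 srt pos F32 lt.
have K23 : 2 / 3 <= nv p' q' ms'.
  have := normal_value_ge p' q' ms'0; have := ler0n R p'; have := ler0n R q'.
  have := ler0n R (size ms'); have : 1 <= (p' + q' + size ms')%N%:R :> R by rewrite ler1n.
  by rewrite !natrD; lra.
(* As 2 F - 3 >= 0, the inequality survives when K is replaced by a lower bound. *)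
have ub c : c <= nv p' q' ms' -> c * (2 * nv p q ms - 3) < nv p q ms - 1.
  by move=> h; apply: le_lt_trans lt; rewrite ler_wpM2r //; lra.
have F3 : nv p q ms < 3 by have := ub _ K23; lra.
have ge := normal_value_ge p q ms0; have le := sum_weight_le ms.
have p0 := ler0n R p; have q0 := ler0n R q; have n0 := ler0n R (size ms).
have pE : (p < 1)%N by rewrite -(ltr_nat R); lra.
have qE : (q < 2)%N by rewrite -(ltr_nat R); lra.
have nE : (size ms < 5)%N by rewrite -(ltr_nat R); lra.
(* K >= 1 would give F < 2. *)
have K1 : 2 <= nv p q ms -> exists t, [/\ (0 < t)%N, p' = 0%N, q' = 0%N & ms' = [:: t]].
  by move=> h; apply: normal_value_lt1 => //; rewrite ltNge; apply/negP => /ub; lra.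
(* K >= 5/7 would give F < 8/3, and already [weight 2] is 4/5. *)
have K2 : 8 / 3 <= nv p q ms -> [/\ p' = 0%N, q' = 0%N & ms' = [:: 1%N]].
  move=> h; have [|t [t0 -> -> E]] := K1; first by lra.
  split=> //; have : nv p' q' ms' < 5 / 7 by rewrite ltNge; apply/negP => /ub; lra.
  rewrite E /normal_value big_seq1 => lt5; congr [:: _]; apply/eqP.
  rewrite eqn_leq t0 andbT leqNgt; apply/negP => /(weight_mono R); rewrite weight2.
  have := ler0n R p'; have := ler0n R q'; lra.
case: p {ge p0} pE F32 F3 K1 K2 lt ub => [|//] _ F32 F3 K1 K2 _ _; split=> //.
have w1 := weight1 R; have w2 := weight2 R; have w3 := weight3 R; have w4 := weight4 R.
have wge m : (0 < m)%N -> 2 / 3 <= wt m by move=> /(weight_mono R); rewrite w1.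
have sum2 m n l : all (ltn 0) [:: m, n & l] -> 4 / 3 <= \sum_(i <- [:: m, n & l]) wt i.
  by move/(sum_weight_ge R); rewrite /= -[(size l).+2%:R]natr1 -[(size l).+1%:R]natr1;
    have := ler0n R (size l); lra.
case: q qE F32 F3 K1 K2 {q0} => [|[|//]] _; rewrite /normal_value => F32 F3 K1 K2.
  case: ms ms0 srt le {n0} nE F32 F3 K1 K2
    => [|s1 [|s2 [|s3 [|s4 [|//]]]]] ms0 srt le _ F32 F3 K1 K2.
  - by rewrite big_nil in F32; lra.
  - by rewrite /= in le; lra.
  - by apply: Or44; split=> //; exists s1, s2.
  - have [|t [t0 pE' qE' E]] := K1.
      by move: (sum_weight_ge R ms0) => /=; lra.
    by apply: Or43; split=> //; exists s1, s2, s3, t.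
  have [|pE' qE' E] := K2; first by move: (sum_weight_ge R ms0) => /=; lra.
  apply: Or42; split=> //; exists s1, 1%N; split=> //; split=> //.
  move: ms0 srt F3; rewrite !big_cons big_nil /=.
  move=> /and5P[s10 s20 s30 s40 _] /and4P[s21 s32 s43 _] F3.
  have b1 := wge _ s10; have b2 := wge _ s20; have b3 := wge _ s30; have b4 := wge _ s40.
  (* The bound F < 3 successively excludes 3 (4/5) + 2/3, 2 (6/7) + 4/3 and 8/9 + 4/5 + 4/3. *)
  have s3E : s3 = 1%N.
    apply/eqP; rewrite eqn_leq s30 andbT leqNgt; apply/negP => h.
    have := weight_mono R h; have := weight_mono R s32; have := weight_mono R s21.
    by rewrite w2; lra.
  have s4E : s4 = 1%N by apply/eqP; rewrite eqn_leq s40 andbT -s3E.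
  move: F3; rewrite s3E s4E w1 => F3.
  have [h|h] := leqP s2 1.
    by left; have -> : s2 = 1%N by apply/eqP; rewrite eqn_leq h s20.
  right; have c2 := weight_mono R h; have c1 := weight_mono R s21.
  have s2E : s2 = 2%N.
    apply/eqP; rewrite eqn_leq h andbT leqNgt; apply/negP => /(weight_mono R).
    by rewrite w3; lra.
  rewrite s2E; split=> //; rewrite -{1}s2E s21 /= leqNgt; apply/negP => /(weight_mono R).
  by rewrite w4; rewrite s2E w2 in F3; lra.
case: ms ms0 srt le {n0} nE F32 F3 K1 K2 => [|s [|s2 ms]] ms0 srt le _ F32 F3 K1 K2.
- apply: Or41; split=> //; have [|t [t0 pE' qE' E]] := K1; first by rewrite big_nil; lra.
  by exists 1%N, t; split=> //; left.
- have s0 : (0 < s)%N by move: ms0; rewrite /= andbT.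
  apply: Or41; split=> //; have [|pE' qE' E] := K2.
    by rewrite big_seq1; have := wge _ s0; lra.
  by exists s, 1%N; split=> //; right.
by exfalso; have := sum2 _ _ _ ms0; lra.
Qed.

(** With F the sum of the two weights, a paw in the second factor gives K >= 8, so F < 23/15, which
    leaves only the sizes 3, 1. A P_3 gives K >= 2, so F < 5/3, which for t > 1 leaves 2, 2 and 3,
    2. *)
Lemma two_weights_cases s t p q ms : all (ltn 0) ms -> (0 < t <= s)%N ->
  3 / 2 <= wt s + wt t -> nv p q ms * (2 * (wt s + wt t) - 3) < wt s + wt t - 1 ->
  [\/ [/\ t = 1%N, (2 < s)%N & p = 0%N],
      [/\ t = 1%N, s = 3%N, p = 1%N & q = 0%N \/ q = 1%N /\ (size ms <= 1)%N],
      [/\ (1 < t)%N, p = 0%N & q = 0%N] |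
      [/\ t = 2%N, p = 0%N, q = 1%N &
          s = 2%N /\ (size ms <= 1)%N \/ s = 3%N /\ ms = [::]]].
Proof.
move=> ms0 /andP[t0 ts] F32 lt; have ge := normal_value_ge p q ms0.
have p0 := ler0n R p; have q0 := ler0n R q; have n0 := ler0n R (size ms).
have ub c : c <= nv p q ms -> c * (2 * (wt s + wt t) - 3) < wt s + wt t - 1.
  by move=> h; apply: le_lt_trans lt; rewrite ler_wpM2r //; lra.
have w1 := weight1 R; have w2 := weight2 R; have w3 := weight3 R; have w4 := weight4 R.
have [t2|t2] := leqP t 1.
  have tE : t = 1%N by apply/eqP; rewrite eqn_leq t2.
  move: F32 lt ub; rewrite tE w1 => F32 lt ub.
  have s3 : (2 < s)%N by rewrite ltnNge; apply/negP => /(weight_mono R); lra.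
  have [->|p1] := posnP p; first exact: Or41.
  have p1' := natr_ge p1.
  have K8 : 8 <= nv p q ms by lra.
  have sE : s = 3%N.
    apply/eqP; rewrite eqn_leq s3 andbT leqNgt; apply/negP => /(weight_mono R).
    by have := ub _ K8; lra.
  (* Now F = 32/21, and the inequality becomes K < 11. *)
  move: lt; rewrite sE w3 => lt.
  have pE : p = 1%N.
    by apply/eqP; rewrite eqn_leq p1 andbT -ltnS -(ltr_nat R); lra.
  apply: Or42; split=> //; have [|q1] := posnP q; first by left.
  have qE : q = 1%N.
    apply/eqP; rewrite eqn_leq q1 andbT -ltnS -(ltr_nat R); lra.
  right; split=> //; apply: sum_weight_lt1 => //.
  by move: lt; rewrite /normal_value pE qE; lra.
have v2 := weight_mono R t2; have v2' := weight_mono R (leq_trans t2 ts).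
have pE : p = 0%N.
  have [//|p1] := posnP p; have p1' := natr_ge p1.
  have K8 : 8 <= nv p q ms by lra.
  by exfalso; have := ub _ K8; lra.
have [->|q1] := posnP q; first exact: Or43.
have q1' := natr_ge q1.
have K2 : 2 <= nv p q ms by lra.
have K2' := ub _ K2.
have tE : t = 2%N.
  apply/eqP; rewrite eqn_leq t2 andbT leqNgt; apply/negP => h.
  by have := weight_mono R h; have := weight_mono R (leq_trans h ts); lra.
move: lt K2' ub; rewrite tE w2 => lt K2' ub.
have s3 : (s <= 3)%N by rewrite leqNgt; apply/negP => /(weight_mono R); lra.
have [s2|s2] := leqP s 2.
  have sE : s = 2%N by apply/eqP; rewrite eqn_leq s2 (leq_trans t2 ts).
  (* Now F = 8/5, and the inequality becomes K < 3. *)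
  move: lt; rewrite sE w2 => lt.
  have qE : q = 1%N.
    by apply/eqP; rewrite eqn_leq q1 andbT -ltnS -(ltr_nat R); lra.
  apply: Or44; split=> //; left; split=> //; apply: sum_weight_lt1 => //.
  by move: lt; rewrite /normal_value pE qE; lra.
have sE : s = 3%N by apply/eqP; rewrite eqn_leq s3 s2.
(* Now F = 58/35, and the inequality becomes K < 23/11, too small for any factor beside one P_3. *)
move: lt; rewrite sE w3 => lt.
have qE : q = 1%N.
  by apply/eqP; rewrite eqn_leq q1 andbT -ltnS -(ltr_nat R); lra.
apply: Or44; split=> //; right; split=> //; apply/eqP; rewrite -size_eq0 -leqn0 -ltnS.
by rewrite -(ltr_nat R); lra.
Qed.

Lemma doubleS_gt0 m : 0 < 2 * m%:R + 1 :> R.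
Proof. by have := ler0n R m; lra. Qed.

(** The difference of the two sides is alpha - t beta up to a positive factor. Division requires
    beta > 0; [beta] vanishes at s1 = s2 = s3 = 1, which is why that case is a separate family. *)
Lemma threshold_alpha_beta s1 s2 s3 t :
  (1 < s1)%N -> (0 < s2)%N -> (0 < s3)%N ->
  (wt t * (2 * (wt s1 + wt s2 + wt s3) - 3) < wt s1 + wt s2 + wt s3 - 1) =
  (t%:R < alpha R s1 s2 s3 / beta R s1 s2 s3).
Proof.
move=> /natr_ge s10 /natr_ge s20 /natr_ge s30.
have b0 : 0 < beta R s1 s2 s3.
  rewrite /beta; move: s10 s20 s30; move: (s1%:R) (s2%:R) (s3%:R) => a b c ha hb hc.
  have bc : b + c - 1 <= b * c.
    have : 0 <= (b - 1) * (c - 1) by rewrite mulr_ge0 ?subr_ge0.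
    by lra.
  have : 0 <= (a - 2) * (b * c - 1) by rewrite mulr_ge0 ?subr_ge0 //; lra.
  by lra.
have d1 := doubleS_gt0 s1; have d2 := doubleS_gt0 s2; have d3 := doubleS_gt0 s3.
have dt := doubleS_gt0 t.
rewrite ltr_pdivlMr // -subr_gt0 -[RHS]subr_gt0.
have -> : wt s1 + wt s2 + wt s3 - 1 - wt t * (2 * (wt s1 + wt s2 + wt s3) - 3) =
  (alpha R s1 s2 s3 - t%:R * beta R s1 s2 s3) *
  ((2 * s1%:R + 1) * (2 * s2%:R + 1) * (2 * s3%:R + 1) * (2 * t%:R + 1))^-1.
  by rewrite /weight /alpha /beta; field; rewrite !gt_eqF.
by rewrite pmulr_lgt0 // invr_gt0 !mulr_gt0.
Qed.

Lemma threshold_gamma p t k (s : nat -> nat) (w := \sum_(p.+2 <= i < k.+1) wt (s i)) :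
  ((2 * p%:R + w) * (2 * (wt t + wt 1) - 3) < wt t + wt 1 - 1) =
  (gamma R p t k s < 0).
Proof.
have dt := doubleS_gt0 t; rewrite weight1 -subr_gt0 -[RHS]oppr_gt0.
have -> : wt t + 2 / 3 - 1 - (2 * p%:R + w) * (2 * (wt t + 2 / 3) - 3) =
  - gamma R p t k s * (3 * (2 * t%:R + 1))^-1.
  by rewrite /gamma -/(weight R _) -/w /weight; field; rewrite gt_eqF.
by rewrite pmulr_lgt0 // invr_gt0 !mulr_gt0.
Qed.

(** At 1/2 the quotients s / (1/2 + s) are the weights, and - delta is the difference of the two
    sides up to a positive factor. *)
Lemma threshold_delta a t k (s : nat -> nat) (w := \sum_(2 <= i < k.+1) wt (s i)) :
  (w * (2 * (wt a + wt t) - 3) < wt a + wt t - 1) =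
  (delta (1 / 2 : R) a t k s < 0).
Proof.
have dt := doubleS_gt0 t; have da := doubleS_gt0 a.
rewrite -subr_gt0 -[RHS]oppr_gt0.
have wE : \sum_(2 <= i < k.+1) (s i)%:R / (1 / 2 + (s i)%:R) = w.
  apply: eq_bigr => i _; rewrite /weight; have := ler0n R (s i) => si.
  by field; rewrite ?andbT; do ?[apply/andP; split]; apply/eqP; lra.
have -> : wt a + wt t - 1 - w * (2 * (wt a + wt t) - 3) =
  - delta (1 / 2) a t k s * (8 / ((2 * a%:R + 1) * (2 * t%:R + 1))).
  by rewrite /delta wE /weight; field; rewrite !gt_eqF.
by rewrite pmulr_lgt0 // divr_gt0 ?mulr_gt0.
Qed.

End Enumeration.

(** * The classification *)

Lemma multipartite_nth ms a k : k.+1 = a + size ms ->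
  multipartite (fun i => nth 0 ms (i - a)) a k = edgeless_join ms.
Proof. by move=> kE; rewrite multipartiteE kE map_nth_index_iota. Qed.

Lemma nth_gt0 ms a k : all (ltn 0) ms -> k.+1 = a + size ms ->
  forall i, a <= i <= k -> 0 < nth 0 ms (i - a).
Proof.
move=> /(all_nthP 0) ms0 kE i /andP[ai ik]; apply: ms0.
by rewrite ltn_subLR // -kE.
Qed.

Lemma card_normal_form0 : #|normal_form 0 0 [::]| = 0.
Proof. by rewrite !card_sum !card_ord. Qed.

(** Covers the families in which a last factor of size 0 means an absent one. *)
Lemma normal_form_seq0 p q : giso (normal_form p q [:: 0]) (normal_form p q [::]).
Proof.
by apply: giso_join; [reflexivity | apply: giso0; rewrite ?card_sum !card_ord].
Qed.

Section Classification.
Variable R : rcfType.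
Local Open Scope ring_scope.
Local Notation nv := (normal_value R).
Local Notation wt := (weight R).

Lemma sum_weight_nth ms a k : k.+1 = (a + size ms)%N ->
  \sum_(a <= i < k.+1) wt (nth 0%N ms (i - a)) = \sum_(m <- ms) wt m.
Proof. by move=> kE; rewrite -[in RHS](map_nth_index_iota ms a) big_map -kE. Qed.

Lemma eigval2_normal_form (G : sgraph) p q ms : (2 <= #|G|)%N ->
  giso G (normal_form p q ms) -> eigval R 2 G < 1 / 2.
Proof.
move=> G2 E; apply: eigval2_hyperplane_pos => //.
exact: hyperplane_pos_emb (giso_emb E)
  (posdef_hyperplane_pos (value_normal_form _ _ _ _)).
Qed.

Lemma eigval2_cone_join (G : sgraph) p q ms p' q' ms' : (2 <= #|G|)%N ->
  3 / 2 <= nv p q ms -> nv p' q' ms' * (2 * nv p q ms - 3) < nv p q ms - 1 ->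
  giso G (('K_1 :+: normal_form p q ms) :\/: normal_form p' q' ms') ->
  eigval R 2 G < 1 / 2.
Proof.
move=> G2 F32 lt E; apply: eigval2_hyperplane_pos => //.
apply: hyperplane_pos_emb (giso_emb E) _.
by apply: cone_join_sufficient F32 lt; apply: value_normal_form.
Qed.

Lemma normal_value_gt0 p q ms : all (ltn 0) ms -> (0 < p + q + size ms)%N ->
  0 < nv p q ms.
Proof.
move=> ms0 pos; have := normal_value_ge R p q ms0.
have := ler0n R p; have := ler0n R q; have := ler0n R (size ms).
have : 1 <= (p + q + size ms)%N%:R :> R by rewrite ler1n.
by rewrite !natrD; lra.
Qed.

Lemma normal_value_perm p q ms ms' : perm_eq ms ms' -> nv p q ms = nv p q ms'.
Proof. by move=> E; rewrite /normal_value (perm_big _ E). Qed.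

(** Connectedness removes from [plane_pos_structure] every outcome in which G has an isolated
    vertex. The sizes inside the cone are sorted to shorten the enumeration. *)
Lemma eigval2_structure (G : sgraph) : (2 <= #|G|)%N -> connectedg G ->
  eigval R 2 G < 1 / 2 ->
  (exists p q ms, [/\ all (ltn 0) ms, (2 <= p + q + size ms)%N &
     giso G (normal_form p q ms)]) \/
  (exists p q ms p' q' ms', [/\ [/\ all (ltn 0) ms, all (ltn 0) ms',
      sorted geq ms & (0 < p' + q' + size ms')%N], 3 / 2 <= nv p q ms,
      nv p' q' ms' * (2 * nv p q ms - 3) < nv p q ms - 1 &
      giso G (('K_1 :+: normal_form p q ms) :\/: normal_form p' q' ms')]).
Proof.
move=> G2 conn /(plane_pos_eigval2 G2) pos.
have noncone G1 : ~ giso G ('K_1 :+: G1) by apply: connectedg_cone.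
case: (plane_pos_structure pos) => [[p [q [ms [ms0 E]]]]||[G1 /noncone//]].
  left; exists p, q, ms; split=> //.
  case: (ltngtP (p + q + size ms) 1) => // [|/(normal_form_cone ms0)[G1 E1]].
    case: p q ms {ms0} E => [|//] [|//] [|//] E _.
    have [f bf _] := E; move: G2; rewrite (bij_eq_card bf) card_normal_form0 //.
  by case: (noncone G1); rewrite E E1; reflexivity.
move=> [p [q [ms [p' [q' [ms' [ms0 ms'0 F32 E]]]]]]]; right.
have pos' : (0 < p' + q' + size ms')%N.
  case: p' q' ms' {ms'0} E => [|//] [|//] [|//] E.
  by case: (noncone (normal_form p q ms)); rewrite E (gjoing0 _ card_normal_form0); reflexivity.
have perm : perm_eq ms (sort geq ms) by rewrite perm_sym perm_sort.
exists p, q, (sort geq ms), p', q', ms'; rewrite -(normal_value_perm p q perm).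
rewrite (all_sort _ _ _) ms0 ms'0; split=> //.
- by split=> //; apply: sort_sorted => x y; rewrite /geq /= leq_total.
- apply: cone_join_necessary F32 _ (plane_pos_emb (giso_emb (giso_sym E)) pos);
    [exact: value_normal_form | exact: value_normal_form | exact: normal_value_gt0].
by rewrite E (normal_form_perm p q perm); reflexivity.
Qed.

End Classification.

Theorem theorem2p4 (R : rcfType) (G : sgraph)
    (hord : 2 <= #|G|) (hconn : connectedg G) :
  (eigval R 2 G < 1 / 2)%R
  <->
  (
  (* 1 *)
  (exists s : nat, 1 <= s /\
    giso G ((gcompl 'K_2 :+: 'K_2) :\/: gcompl 'K_s))
  \/
  (* 2 *)
  (exists s : nat, 1 <= s /\
    giso G (('K_1 :+: (gcompl 'K_s :\/: gcompl 'P_3)) :\/: 'K_1))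
  \/
  (* 3 *)
  (exists s : nat, 1 <= s /\
    giso G (('K_1 :+: (gcompl 'K_s :\/: 'K_3)) :\/: 'K_1))
  \/
  (* 4 *)
  (exists s : nat, 2 <= s <= 3 /\
    giso G (('K_1 :+: (gcompl 'K_s :\/: gcompl 'K_2 :\/: 'K_2)) :\/: 'K_1))
  \/
  (* 5 *)
  (exists s1 s2 s3 t : nat,
    [/\ [/\ s2 <= s1, s3 <= s2 & 1 <= s3], 1 < s1, 1 <= t,
        (t%:R < alpha R s1 s2 s3 / beta R s1 s2 s3)%R &
        giso G (('K_1 :+: (gcompl 'K_s1 :\/: gcompl 'K_s2 :\/: gcompl 'K_s3))
                :\/: gcompl 'K_t)])
  \/
  (* 6 *)
  (exists t : nat, 1 <= t /\
    giso G (('K_1 :+: 'K_3) :\/: gcompl 'K_t))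
  \/
  (* 7 *)
  (exists (k p q : nat) (s : nat -> nat),
    [/\ 2 <= k, p + q <= k,
        forall i, p + q + 1 <= i <= k -> 1 <= s i &
        giso G ((join_copies p ('K_1 :+: 'K_(1, 2))) :\/: (join_copies q ('K_1 :+: 'K_(1, 1)))
                :\/: multipartite s (p + q + 1) k)])
  \/
  (* 8 *)
  (exists (k p t : nat) (s : nat -> nat),
    [/\ [/\ 2 <= k, p + 1 <= k & 3 <= t],
        forall i, p + 2 <= i <= k -> 1 <= s i,
        (gamma R p t k s < 0)%R &
        giso G (('K_1 :+: 'K_(1, t)) :\/: (join_copies p ('K_1 :+: 'K_(1, 1)))
                :\/: multipartite s (p + 2) k)])
  \/
  (* 9 *)
  (exists (k : nat) (s : nat -> nat),
    [/\ 2 <= k,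
        forall i, 3 <= i <= k -> 1 <= s i,
        (\sum_(3 <= i < k.+1) (2 * (s i)%:R) / (2 * (s i)%:R + 1) < 3 :> R)%R &
        giso G (('K_1 :+: 'K_(1, 3)) :\/: ('K_1 :+: 'K_(1, 2))
                :\/: multipartite s 3 k)])
  \/
  (* 10 *)
  (exists s : nat,
    giso G (('K_1 :+: 'K_(1, 3)) :\/: ('K_1 :+: 'K_(1, 2))
            :\/: ('K_1 :+: 'K_(1, 1)) :\/: gcompl 'K_s))
  \/
  (* 11 *)
  (exists s : nat,
    giso G (('K_1 :+: 'K_(2, 2)) :\/: ('K_1 :+: 'K_(1, 1)) :\/: gcompl 'K_s))
  \/
  (* 12 *)
  giso G (('K_1 :+: 'K_(2, 3)) :\/: ('K_1 :+: 'K_(1, 1)))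
  \/
  (* 13 *)
  (exists (k a t : nat) (s : nat -> nat),
    [/\ [/\ 2 <= k, 2 <= a & 2 <= t],
        forall i, 2 <= i <= k -> 1 <= s i,
        (delta (1 / 2 : R) a t k s < 0)%R &
        giso G (('K_1 :+: 'K_(a, t)) :\/: multipartite s 2 k)])).
Proof.
have w1 := weight1 R; have w2 := weight2 R; have w3 := weight3 R; have w4 := weight4 R.
split.
  move/(eigval2_structure hord hconn) => [[p [q [ms [ms0 k2 E]]]]|].
    (* The number k of join factors is p + q plus the number of edgeless factors. *)
    do 6 right; left; have kE : (p + q + size ms).+1 = p + q + 1 + size ms by rewrite addn1.
    exists (p + q + size ms), p, q, (fun i => nth 0 ms (i - (p + q + 1))).
    split=> //; first exact: leq_addr.
      exact: nth_gt0.
    by rewrite (multipartite_nth kE).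
  move=> [p [q [ms [p' [q' [ms' [[ms0 ms'0 srt pos] F32 lt E]]]]]]].
  have [pE cases] := admissible_cases ms0 ms'0 srt pos F32 lt.
  rewrite {p}pE in F32 lt E.
  case: cases => [[qE [s [t [t0 p'E q'E ms'E [msE|[s0 [tE msE]]]]]]]
    |[qE [s [t [t0 p'E q'E ms'E [tE]]]]]|[qE]|[qE]].
  - left; exists t; split=> //; move: E; rewrite qE msE p'E q'E ms'E => E.
    by rewrite E graph1E; reflexivity.
  - right; left; exists s; split=> //; move: E; rewrite qE msE p'E q'E ms'E tE => E.
    by rewrite E graph2E; reflexivity.
  - move: E; rewrite qE p'E q'E ms'E tE => E [msE|[s23 msE]].
      do 2 right; left; exists s; move: E ms0; rewrite msE => E /andP[s0 _]; split=> //.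
      by rewrite E graph3E; reflexivity.
    do 3 right; left; exists s; split=> //; rewrite E msE graph4E; reflexivity.
  - move=> [s1 [s2 [s3 [t [t0 p'E q'E ms'E msE]]]]].
    move: E srt ms0 lt; rewrite qE p'E q'E ms'E msE /= => E.
    move=> /and3P[s21 s32 _] /and4P[s10 s20 s30 _].
    rewrite /normal_value ?big_cons ?big_nil => lt.
    (* If the largest size is 1, the core is K_3 and [t] is unrestricted. *)
    have [s11|s11] := leqP s1 1.
      have s1E : s1 = 1 by apply/eqP; rewrite eqn_leq s11.
      have s2E : s2 = 1 by apply/eqP; rewrite eqn_leq s20 -s1E s21.
      have s3E : s3 = 1 by apply/eqP; rewrite eqn_leq s30 -s2E s32.
      do 5 right; left; exists t; split=> //.
      by rewrite E s1E s2E s3E graph6E; reflexivity.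
    do 4 right; left; exists s1, s2, s3, t; split=> //.
      by rewrite -threshold_alpha_beta //; lra.
    by rewrite E graph5E; reflexivity.
  move=> [s [t msE]].
  move: E srt ms0 F32 lt; rewrite qE msE => E /andP[ts _] /and3P[s0 t0 _] F32 lt.
  have FE : normal_value R 0 0 [:: s; t] = (weight R s + weight R t)%R.
    by rewrite /normal_value ?big_cons ?big_nil; lra.
  rewrite FE in F32 lt.
  have ts' : 0 < t <= s by apply/andP.
  have := two_weights_cases ms'0 ts' F32 lt.
  case=> [[tE s3 p'E]|[tE sE p'E q'C]|[t2 p'E q'E]|[tE p'E q'E sC]].
  - do 7 right; left; move: E pos lt; rewrite tE p'E => E pos lt.
    (* One factor is the large cone and [q'] are copies of K_1 with an edge, so the edgeless factors
       start at index q' + 2. *)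
    have kE : (q' + size ms' + 1).+1 = q' + 2 + size ms' by rewrite addn1 (addnAC q' 2) addn2.
    exists (q' + size ms' + 1), q', s, (fun i => nth 0 ms' (i - (q' + 2))).
    split.
    + split=> //; first by rewrite addn1 ltnS.
      by rewrite leq_add2r leq_addr.
    + exact: nth_gt0.
    + rewrite -threshold_gamma -(addn2 q') (sum_weight_nth R kE).
      by move: lt; rewrite /normal_value !w1; lra.
    by rewrite (multipartite_nth kE) E graph8E; reflexivity.
  - move: E lt; rewrite tE sE p'E => E lt.
    case: q'C => [q'E|[q'E le1]].
      do 8 right; left; move: E lt; rewrite q'E => E lt.
      have kE : (2 + size ms').+1 = 3 + size ms' by [].
      exists (2 + size ms'), (fun i => nth 0 ms' (i - 3)); split=> //.
      + exact: nth_gt0.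
      + rewrite -[X in (X < _)%R]/(\sum_(3 <= i < (2 + size ms').+1)
          weight R (nth 0 ms' (i - 3)))%R.
        rewrite (sum_weight_nth R kE).
        by move: lt; rewrite /normal_value w1 w3; lra.
      by rewrite (multipartite_nth kE) E graph9E; reflexivity.
    do 9 right; left; move: E; rewrite q'E => E.
    case: ms' le1 E {ms'0 pos lt} => [|s' [|//]] _ E; [exists 0 | exists s'];
      rewrite E graph10E; last reflexivity.
    by rewrite normal_form_seq0; reflexivity.
  - do 12 right; move: E pos lt; rewrite p'E q'E => E pos lt.
    have kE : (size ms').+1.+1 = 2 + size ms' by [].
    exists (size ms').+1, s, t, (fun i => nth 0 ms' (i - 2)); split.
    + by split=> //; apply: leq_trans ts.
    + exact: nth_gt0.
    + rewrite -threshold_delta (sum_weight_nth R kE).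
      by move: lt; rewrite /normal_value; lra.
    by rewrite (multipartite_nth kE) E graph13E; reflexivity.
  move: E; rewrite tE p'E q'E => E; case: sC => [[sE le1]|[sE ms'E]].
    do 10 right; left; rewrite sE in E.
    case: ms' le1 E {ms'0 pos lt} => [|s' [|//]] _ E; [exists 0 | exists s'];
      rewrite E graph11E; last reflexivity.
    by rewrite normal_form_seq0; reflexivity.
  do 11 right; left; rewrite E sE ms'E graph12E; reflexivity.
(* Conversely, each listed graph is either a normal form or a cone joined to one, and in the latter
   case only F >= 3/2 and K (2 F - 3) < F - 1 are to be checked. *)
have wge m : 0 < m -> (2 / 3 <= weight R m)%R by move=> /(weight_mono R); rewrite w1.
case=> [[s [s0 E]]|]; first by
  apply: (eigval2_cone_join hord _ _ (giso_trans E (graph1E s)));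
  rewrite /normal_value ?big_cons ?big_nil; have := weight_lt1 R s; lra.
case=> [[s [s0 E]]|].
  apply: (eigval2_cone_join hord _ _ (giso_trans E (graph2E s)));
  by rewrite /normal_value ?big_cons ?big_nil ?w1; have := weight_lt1 R s; have := wge _ s0; lra.
case=> [[s [s0 E]]|].
  apply: (eigval2_cone_join hord _ _ (giso_trans E (graph3E s)));
  by rewrite /normal_value ?big_cons ?big_nil ?w1; have := weight_lt1 R s; have := wge _ s0; lra.
case=> [[s [/andP[s2 s3] E]]|].
  apply: (eigval2_cone_join hord _ _ (giso_trans E (graph4E s)));
  rewrite /normal_value ?big_cons ?big_nil ?w1 ?w2;
  by have := weight_mono R s2; have := weight_mono R s3; rewrite w2 w3; lra.
case=> [[s1 [s2 [s3 [t [[s21 s32 s30] s11 t0 lt E]]]]]|].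
  have s20 : 0 < s2 by apply: leq_trans s32.
  rewrite -threshold_alpha_beta // in lt.
  apply: (eigval2_cone_join hord _ _ (giso_trans E (graph5E s1 s2 s3 t)));
  rewrite /normal_value ?big_cons ?big_nil.
    by have := wge _ s20; have := wge _ s30; have := wge _ (ltnW s11); lra.
  by lra.
case=> [[t [t0 E]]|].
  apply: (eigval2_cone_join hord _ _ (giso_trans E (graph6E t)));
  by rewrite /normal_value ?big_cons ?big_nil ?w1; have := weight_lt1 R t; lra.
case=> [[k [p [q [s [k2 pqk s0 E]]]]]|].
  rewrite multipartiteE in E; exact: eigval2_normal_form E.
case=> [[k [p [t [s [[k2 pk t3] s0 lt E]]]]]|].
  rewrite multipartiteE in E; rewrite -threshold_gamma in lt.
  apply: (eigval2_cone_join hord _ _ (giso_trans E (graph8E _ _ _)));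
  rewrite /normal_value ?big_cons ?big_nil.
    by have := weight_mono R t3; rewrite w1 w3; lra.
  by rewrite big_map addn2; lra.
case=> [[k [s [k2 s0 lt E]]]|].
  rewrite multipartiteE in E.
  apply: (eigval2_cone_join hord _ _ (giso_trans E (graph9E _)));
  rewrite /normal_value ?big_cons ?big_nil ?w1 ?w3; first by lra.
  rewrite big_map; rewrite -[X in (X < _)%R]/(\sum_(3 <= i < k.+1) weight R (s i))%R in lt.
  by lra.
case=> [[s E]|].
  apply: (eigval2_cone_join hord _ _ (giso_trans E (graph10E _)));
  by rewrite /normal_value ?big_cons ?big_nil ?w1 ?w3; have := weight_lt1 R s; lra.
case=> [[s E]|].
  apply: (eigval2_cone_join hord _ _ (giso_trans E (graph11E _)));
  by rewrite /normal_value ?big_cons ?big_nil ?w2; have := weight_lt1 R s; lra.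
case=> [E|[k [a [t [s [[k2 a2 t2] s0 lt E]]]]]].
  apply: (eigval2_cone_join hord _ _ (giso_trans E graph12E));
  by rewrite /normal_value ?big_cons ?big_nil ?w2 ?w3; lra.
rewrite multipartiteE in E; rewrite -threshold_delta in lt.
apply: (eigval2_cone_join hord _ _ (giso_trans E (graph13E _ _ _)));
rewrite /normal_value ?big_cons ?big_nil.
  by have := weight_mono R a2; have := weight_mono R t2; rewrite w2; lra.
by rewrite big_map; lra.
Qed.
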